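(* Let $X$ be the blow-up of $\mathbb{P}^1\times\mathbb{P}^1$ over $\mathbb{Q}$ in $z_1=([0:1],[1:0])$ and $z_2=([1:0],[0:1])$, let $D\subset X$ be the strict transform of $\{s_0t_0=s_1t_1\}$, and let $\mathfrak{X}$, $\mathfrak{D}$, $\mathfrak{U}=\mathfrak{X}\setminus\mathfrak{D}$ be the integral models described in the context. Let $x=([1:1],[1:1])\in D(\mathbb{Q})$, and let $L_1$ and $L_2$ be the strict transforms in $X$ of the lines $s_0=s_1$ and $t_0=t_1$. Then $$\alpha(x,\mathfrak{U};-K_X(D))=\alpha(x,L_i\cap\mathfrak{U};-K_X(D))=1\qquad\text{for } i\in\{1,2\}.$$ In particular, the integral analog of McKinnon's conjecture holds for $X$ (with the log scheme $(\mathfrak{X},\mathfrak{D})$), that is: for every point $p\in D(\mathbb{Q})$ lying on a minimal stratum of $D$ and every ample line bundle $L$ on $X$, there exists a rational curve $\mathfrak{C}$ on $(\mathfrak{X},\mathfrak{D})$ which is either log rational or toroidal such that $$\alpha(p,\mathfrak{U};L)=\alpha(p,\mathfrak{C}\setminus\mathfrak{D};L).$$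
   Context: Geometry. $(s_0,s_1)$ and $(t_0,t_1)$ are the homogeneous coordinates on the two factors of $\mathbb{P}^1\times\mathbb{P}^1$. $X$ is a toric surface (a del Pezzo surface of degree 6); $\mathfrak{X}$ is the toric $\mathbb{Z}$-scheme defined by the same fan. $\mathfrak{D}$ is the Zariski closure of $D$ in $\mathfrak{X}$, and $\mathfrak{U}=\mathfrak{X}\setminus\mathfrak{D}$. A rational point $([s_0:s_1],[t_0:t_1])$ away from $z_1,z_2$, written with coprime integers in each pair, is integral on $\mathfrak{U}$ iff $s_0t_0-s_1t_1\in\{\pm\gcd(s_0,t_1)\gcd(s_1,t_0)\}$. The log anticanonical class $-K_X(D)=-K_X-D$ is the pullback of $\mathcal{O}(1,1)$; it is big and nef, but not ample. The conjecture. It concerns weakly log Fano schemes (flat projective log schemes whose generic fiber $X$ is regular, whose boundary $D$ geometrically has strict normal crossings, and with $-K_X-D$ big and nef) satisfying the integral Hilbert property (the set of integral points is not thin); $(\mathfrak{X},\mathfrak{D})$ is such a scheme. It asserts the existence of a rational curve as in the claim for every rational boundary point on a minimal stratum, every archimedean place (here only the real place of $\mathbb{Q}$), and every ample line bundle. The minimal strata of $D$ at the real place are the varieties $Z$ of the maximal pairs $(A,Z)$, where $A$ is a set of geometric components of $D$ invariant under $\mathrm{Gal}(\mathbb{C}/\mathbb{R})$, $Z$ is an irreducible component of $\bigcap_{E\in A}E$ with $Z(\mathbb{R})\neq\emptyset$, and $(A,Z)<(A',Z')$ if $A\subsetneq A'$ and $Z\supsetneq Z'$. Heights and distance. For $-K_X(D)$,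 the height is $H(y)=\max\{|s_0t_0|,|s_0t_1|,|s_1t_0|,|s_1t_1|\}$ for $y\in X(\mathbb{Q})$ with image $([s_0:s_1],[t_0:t_1])$ in coprime integer coordinates. For a general line bundle $L$, $H_L$ is a (multiplicative) Weil height on $X(\mathbb{Q})$ associated with $L$ equipped with an adelic metric; it is well defined up to bounded factors. $d=d_\infty$ is a real distance on $X(\mathbb{R})$ induced by a projective embedding, well defined up to bounded factors; for $y=([s_0:s_1],[t_0:t_1])$ close to $x$ it satisfies $d(x,y)\asymp\max(|s_1/s_0-1|,|t_1/t_0-1|)$. Approximation constant. For $p\in X(\mathbb{R})$, $W\subseteq X(\mathbb{Q})$ and a line bundle $L$: $\alpha(p,W;L)=\infty$ if $p$ is not in the closure of $W\setminus\{p\}$ in $X(\mathbb{R})$; otherwise it is the infimum of all $\alpha\in\mathbb{R}_{>0}$ for which there is a sequence $(y_n)_n\subseteq W\setminus\{p\}$ with $y_n\to p$ and $d(p,y_n)^\alpha H_L(y_n)$ bounded from above. $\alpha(p,\mathfrak{U};L)$ means $W=\mathfrak{U}(\mathbb{Z})$; for a curve $C\subset X$, $\alpha(p,C\cap\mathfrak{U};L)$ means $W=C(\mathbb{Q})\cap\mathfrak{U}(\mathbb{Z})$; for $\mathfrak{C}$ the closure of $C$ in $\mathfrak{X}$, $\alpha(p,\mathfrak{C}\setminus\mathfrak{D};L)$ means the same. Rational curves. A rational curve $\mathfrak{C}$ on $(\mathfrak{X},\mathfrak{D})$ is the closure in $\mathfrak{X}$ of the image $C$ of a nonconstant morphism $\mathbb{P}^1_{\mathbb{Q}}\to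 X$, with log structure $(\mathfrak{C},\mathfrak{D}\cap\mathfrak{C})$. With $\phi\colon\mathbb{P}^1_{\mathbb{Q}}\to C$ the normalization, it is log rational (resp. toroidal) if it is a flat, projective log scheme, $\mathfrak{C}$ is birational to $\mathbb{P}^1_{\mathbb{Z}}$, and $\phi^{-1}(D)$, with reduced structure, has degree at most $1$ (resp. equal to $2$). *)

(* Defs.v *)
(* [R : realType] is the field of real numbers; geometric points are taken over
   the field [R[i]] of complex numbers. *)
From HB Require Import structures.
From mathcomp Require Import all_boot all_order all_algebra.
From mathcomp Require Import mpoly.
From mathcomp Require Import complex.
From mathcomp Require Import boolp classical_sets reals constructive_ereal.
From mathcomp Require Import ereal topology normedtype sequences exp.
From mathcomp Require Import zify ring.

Set Implicit Arguments.
Unset Strict Implicit.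
Unset Printing Implicit Defensive.

Import Order.TTheory GRing.Theory Num.Theory numFieldNormedType.Exports.
Local Open Scope classical_set_scope.
Local Open Scope ring_scope.

(* The fan of P^1 x P^1 has the rays (1,0), (0,-1), (-1,0), (0,1) of the
   invariant curves s0 = 0, t1 = 0, s1 = 0, t0 = 0 (the characters (1,0) and
   (0,1) being s0/s1 and t0/t1).  Blowing up the torus-fixed points
   z1 = (s0 = t1 = 0) and z2 = (s1 = t0 = 0) adds the rays (1,-1) and (-1,1).
   The six rays are listed in cyclic order, so that the maximal cones are
   spanned by the pairs of cyclically consecutive rays. *)

Definition ray (i : 'I_6) : int * int :=
  nth (0, 0) [:: (1, 0); (1, -1); (0, -1); (-1, 0); (-1, 1); (0, 1)] i.

(* strict transforms of s0 = 0, t1 = 0, s1 = 0, t0 = 0; exceptional curves over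
   z1 and z2 *)
Definition rS0 : 'I_6 := @Ordinal 6 0 isT.
Definition rE1 : 'I_6 := @Ordinal 6 1 isT.
Definition rT1 : 'I_6 := @Ordinal 6 2 isT.
Definition rS1 : 'I_6 := @Ordinal 6 3 isT.
Definition rE2 : 'I_6 := @Ordinal 6 4 isT.
Definition rT0 : 'I_6 := @Ordinal 6 5 isT.

Definition neighbours (i j : 'I_6) : bool :=
  (j == i.+1 %% 6 :> nat)%N || (i == j.+1 %% 6 :> nat)%N.

(* Points over a field K, in Cox coordinates: X(K) is the set of y in K^6 such
   that the rays i with y i = 0 span a cone of the fan, modulo the torus
   Hom(Pic X, K^* ).  Since Pic X is free, every K-point arises in this way. *)
Definition coxpt (K : fieldType) (y : 'I_6 -> K) : Prop :=
  forall i j, i != j -> ~~ neighbours i j -> (y i != 0) || (y j != 0).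

Definition same_pt (K : fieldType) (y z : 'I_6 -> K) : Prop :=
  exists l : 'I_6 -> K,
    [/\ forall i, l i != 0,
        \prod_i l i ^ (ray i).1 = 1,
        \prod_i l i ^ (ray i).2 = 1
      & forall i, z i = l i * y i].

(* The same over Z: X(Q) is the set of Z-points of the toric Z-scheme, because
   the latter is proper, and as Pic Z is trivial each of these has integral Cox
   coordinates, satisfying [coxpt] modulo every prime. *)
Definition zpt (y : 'I_6 -> int) : Prop :=
  forall i j, i != j -> ~~ neighbours i j -> coprimez (y i) (y j).

Definition ofZ (K : fieldType) (y : 'I_6 -> int) : 'I_6 -> K :=
  fun i => (y i)%:~R.

(* The blow-up morphism X -> P^1 x P^1.  The exceptional curves are
   y rE1 = 0 and y rE2 = 0. *)
Definition coordS (K : fieldType) (y : 'I_6 -> K) (k : 'I_2) : K :=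
  if k == 0 then y rS0 * y rE1 else y rS1 * y rE2.
Definition coordT (K : fieldType) (y : 'I_6 -> K) (k : 'I_2) : K :=
  if k == 0 then y rT0 * y rE2 else y rT1 * y rE1.

(* The morphism X -> P^1 which resolves the rational map [s0 t0 : s1 t1], whose
   base locus is {z1, z2}; thus X = {s0 t0 u1 = s1 t1 u0} in (P^1)^3. *)
Definition coordU (K : fieldType) (y : 'I_6 -> K) (k : 'I_2) : K :=
  if k == 0 then y rS0 * y rT0 else y rS1 * y rT1.

(* Every line bundle on X is O(A) for a torus-invariant divisor A, given here by
   its six multiplicities; two such are isomorphic iff the divisors differ by
   the divisor of a character.  The global sections of O(A) over T are the
   polynomials in the Cox coordinates which are homogeneous of degree the
   class of A. *)

Definition toric_div := {ffun 'I_6 -> int}.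

Definition lineq (A B : toric_div) : Prop :=
  exists u : int * int,
    forall i, A i - B i = u.1 * (ray i).1 + u.2 * (ray i).2.

Definition monomial_div (m : 'X_{1..6}) : toric_div := [ffun i => (m i)%:Z].

Definition form_of (T : nzRingType) (A : toric_div) (P : {mpoly T[6]}) : Prop :=
  forall m, m \in msupp P -> lineq (monomial_div m) A.

Definition bdiv (i : 'I_6) : toric_div := [ffun j => (j == i)%:R].

Definition anticanonical : toric_div := \sum_i bdiv i.

(* pullback of O(1,1), through the divisor s0 t0 = 0 *)
Definition O11 : toric_div := bdiv rS0 + bdiv rE1 + bdiv rT0 + bdiv rE2.

(* The curve s0 t0 = s1 t1 has multiplicity 1 at z1 and at z2. *)
Definition classD : toric_div := O11 - bdiv rE1 - bdiv rE2.

Definition log_anticanonical : toric_div := anticanonical - classD.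

Section Geometry.
Variable R : realType.
Local Notation C := R[i].
Local Notation cpt := ('I_6 -> C).

Definition globally_generated (A : toric_div) : Prop :=
  forall y : cpt, coxpt y ->
    exists P : {mpoly C[6]}, form_of A P /\ P.@[y] != 0.

(* the degree k part of the subring generated by the sections of O(A) *)
Definition section_form (A : toric_div) (k : nat) (P : {mpoly C[6]}) : Prop :=
  exists (n : nat) (g : 'I_n -> 'I_k -> {mpoly C[6]}),
    (forall i j, form_of A (g i j)) /\ P = \sum_i \prod_j g i j.

(* The morphism given by the complete linear system of A is a closed immersion:
   it is defined everywhere, injective, and surjective on local rings (X being
   complete, it is then a homeomorphism onto a closed subset). *)
Definition very_ample (A : toric_div) : Prop :=
  [/\ globally_generated A,
      forall y z : cpt, coxpt y -> coxpt z ->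
        (exists c : C, c != 0 /\
           forall P : {mpoly C[6]}, form_of A P -> P.@[z] = c * P.@[y]) ->
        same_pt y z
    & forall y : cpt, coxpt y ->
        forall (B : toric_div) (F G : {mpoly C[6]}),
          form_of B F -> form_of B G -> G.@[y] != 0 ->
          exists (k : nat) (P Q : {mpoly C[6]}),
            [/\ section_form A k P, section_form A k Q, Q.@[y] != 0
              & F * Q = G * P]].

Definition ample (A : toric_div) : Prop :=
  exists n : nat, (0 < n)%N /\ very_ample (A *+ n).

(* Closed subsets of X are given by their sets of complex points. *)

Definition zclosed (Z : set cpt) : Prop :=
  exists S : set {mpoly C[6]},
    (forall P, S P -> exists A, form_of A P) /\
    Z = [set y | coxpt y /\ forall P, S P -> P.@[y] = 0].

Definition zclosure (Z : set cpt) : set cpt :=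
  [set y | coxpt y /\ forall A (P : {mpoly C[6]}), form_of A P ->
     (forall z, Z z -> P.@[z] = 0) -> P.@[y] = 0].

(* strict transform in X of the closed subset of P^1 x P^1 on which the
   bihomogeneous equation E (s, t) holds *)
Definition strict_transform (E : ('I_2 -> C) -> ('I_2 -> C) -> Prop) :
    set cpt :=
  zclosure [set y | [/\ coxpt y, E (coordS y) (coordT y),
    ~ (coordS y 0 = 0 /\ coordT y 1 = 0)
    & ~ (coordS y 1 = 0 /\ coordT y 0 = 0)]].

Definition curveD : set cpt :=
  strict_transform (fun s t => s 0 * t 0 = s 1 * t 1).

(* L_1 for [k = 0], and L_2 for [k = 1] *)
Definition lineL (k : 'I_2) : set cpt :=
  strict_transform (fun s t => if k == 0 then s 0 = s 1 else t 0 = t 1).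

(* [vanishZ P]: P is in the homogeneous ideal of the Zariski closure of D in
   the Z-model of X.  A point is integral iff its extension to Spec Z avoids
   this closure at the generic point and at every prime. *)

Definition vanishZ (P : {mpoly int[6]}) : Prop :=
  (exists A, form_of A P) /\
  forall z, curveD z -> (map_mpoly (intr : int -> C) P).@[z] = 0.

Definition integralU : set ('I_6 -> int) :=
  [set y | [/\ zpt y, ~ curveD (ofZ C y)
    & forall p : nat, prime p ->
        ~ (forall P, vanishZ P -> (p%:Z %| P.@[y])%Z)]].

(* The geometric components of D are the components of [curveD]; the Galois group
   of the real place acts by complex conjugation. *)

Definition irreducible (Z : set cpt) : Prop :=
  [/\ zclosed Z, Z !=set0
    & forall Z1 Z2, zclosed Z1 -> zclosed Z2 ->
        Z `<=` Z1 `|` Z2 -> Z `<=` Z1 \/ Z `<=` Z2].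

Definition component (Y Z : set cpt) : Prop :=
  [/\ irreducible Z, Z `<=` Y
    & forall Z', irreducible Z' -> Z `<=` Z' -> Z' `<=` Y -> Z' = Z].

Definition conj_set (E : set cpt) : set cpt :=
  [set y | E (fun i => conjc (y i))].

Definition stratum (A : set (set cpt)) (Z : set cpt) : Prop :=
  [/\ A `<=` component curveD,
      forall E, A E -> A (conj_set E),
      component ((@coxpt C : set cpt) `&` \bigcap_(E in A) E) Z
    & exists y : 'I_6 -> R, coxpt y /\ Z (fun i => (y i)%:C%C)].

Definition minimal_stratum (Z : set cpt) : Prop :=
  exists A, stratum A Z /\
    forall A' Z', stratum A' Z' -> ~ (A `<` A' /\ Z' `<` Z).

(* A morphism P^1_Q -> X in Cox coordinates: six binary forms over Q (the zero
   form having any degree, possibly negative) whose degrees are the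
   intersection numbers of P^1 with the boundary curves. *)

Definition nonzero (z : 'I_2 -> C) : Prop := exists k, z k != 0.

Definition binary_form (d : int) (P : {mpoly rat[2]}) : Prop :=
  P = 0 \/ exists n : nat, d = n%:Z /\ P \is n.-homog.

Definition evalQ (n : nat) (P : {mpoly rat[n]}) (z : 'I_n -> C) : C :=
  (map_mpoly (ratr : rat -> C) P).@[z].

Record p1map := P1map {
  p1deg : 'I_6 -> int;
  p1form : 'I_6 -> {mpoly rat[2]};
  p1form_homog : forall i, binary_form (p1deg i) (p1form i);
  p1deg_fst : \sum_i p1deg i * (ray i).1 = 0;
  p1deg_snd : \sum_i p1deg i * (ray i).2 = 0;
  p1form_coxpt : forall z, nonzero z -> coxpt (fun i => evalQ (p1form i) z)
}.

Definition p1eval (f : p1map) (z : 'I_2 -> C) : cpt :=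
  fun i => evalQ (p1form f i) z.

Definition p1image (f : p1map) : set cpt :=
  [set y | coxpt y /\ exists z, nonzero z /\ same_pt (p1eval f z) y].

Definition nonconstant (f : p1map) : Prop :=
  exists z w, [/\ nonzero z, nonzero w & ~ same_pt (p1eval f z) (p1eval f w)].

Definition rational_curve (Y : set cpt) : Prop :=
  exists f, nonconstant f /\ Y = p1image f.

(* f is birational onto its image Y: some rational function P/Q on X over Q,
   defined at the generic point of Y, pulls back to the coordinate z0/z1.
   This also says that the closure of Y in the Z-model is birational to
   P^1_Z. *)
Definition normalization (f : p1map) (Y : set cpt) : Prop :=
  Y = p1image f /\
  exists (A : toric_div) (P Q : {mpoly rat[6]}),
    [/\ form_of A P, form_of A Q,
        exists z, nonzero z /\ evalQ Q (p1eval f z) != 0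
      & forall z, evalQ P (p1eval f z) * z 1 = evalQ Q (p1eval f z) * z 0].

(* The degree of the reduced preimage of D is its number of geometric points;
   having a degree excludes that Y is contained in D. *)
Definition preimageD_degree (f : p1map) (n : nat) : Prop :=
  exists s : 'I_n -> ('I_2 -> C),
    [/\ forall i, nonzero (s i) /\ curveD (p1eval f (s i)),
        forall i j, s i 0 * s j 1 = s i 1 * s j 0 -> i = j
      & forall z, nonzero z -> curveD (p1eval f z) ->
          exists i, z 0 * s i 1 = z 1 * s i 0].

(* Flatness and projectivity are automatic for the closure of Y. *)
Definition log_rational (Y : set cpt) : Prop :=
  rational_curve Y /\
  exists f n, [/\ normalization f Y, preimageD_degree f n & (n <= 1)%N].

Definition toroidal (Y : set cpt) : Prop :=
  rational_curve Y /\
  exists f, normalization f Y /\ preimageD_degree f 2.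

Definition on_curve (Y : set cpt) : set ('I_6 -> int) :=
  [set y | zpt y /\ Y (ofZ C y)].

(* For O(A) globally generated, the height for the adelic metric defined at the
   finite places by the Z-model and at the real place by the monomial
   sections; the monomial sections have no common prime factor at integral Cox
   coordinates satisfying [zpt]. *)
Definition section_height (A : toric_div) (y : 'I_6 -> int) : R :=
  sup [set h | exists m : 'X_{1..6}, lineq (monomial_div m) A /\
                 h = `|\prod_i (y i)%:~R ^+ m i|].

Definition weil_height (A : toric_div) (H : ('I_6 -> int) -> R) : Prop :=
  exists B B' : toric_div,
    [/\ globally_generated B, globally_generated B', lineq A (B - B')
      & exists c : R, 0 < c /\ forall y, zpt y ->
          c^-1 * (section_height B y / section_height B' y) <= H y
            <= c * (section_height B y / section_height B' y)].

Definition proj_dist (I : finType) (x y : I -> R) : R :=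
  (\big[Num.max/0]_i \big[Num.max/0]_j `|x i * y j - x j * y i|) /
  ((\big[Num.max/0]_i `|x i|) * (\big[Num.max/0]_j `|y j|)).

(* X -> (P^1)^3 -> P^7, the second map being the Segre embedding.  Another
   projective embedding changes [dist] by bounded factors only, which does not
   affect [alpha]. *)
Definition embedding (y : 'I_6 -> R) (k : 'I_2 * 'I_2 * 'I_2) : R :=
  coordS y k.1.1 * coordT y k.1.2 * coordU y k.2.

Definition dist (p y : 'I_6 -> R) : R :=
  proj_dist (embedding p) (embedding y).

Definition punctured (p : 'I_6 -> R) (W : set ('I_6 -> int)) :
    set ('I_6 -> int) :=
  [set y | W y /\ ~ same_pt p (ofZ R y)].

Definition alpha (p : 'I_6 -> R) (W : set ('I_6 -> int))
    (H : ('I_6 -> int) -> R) : \bar R :=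
  if `[< forall e : R, 0 < e ->
           exists y, punctured p W y /\ dist p (ofZ R y) < e >]
  then ereal_inf [set a%:E | a in
         [set a : R | 0 < a /\ exists y : nat -> ('I_6 -> int),
            [/\ forall n, punctured p W (y n),
                dist p (ofZ R (y n)) @[n --> \oo] --> (0 : R)
              & exists M : R, forall n,
                  dist p (ofZ R (y n)) `^ a * H (y n) <= M]]]
  else +oo%E.

(* Weil heights exist for every line bundle, and for -K_X(D) the function
   max |s_i t_j| is one: under [zpt] each of the pairs [coordS] and [coordT]
   consists of coprime integers. *)

Lemma lineq_refl A : lineq A A.
Proof. by exists (0, 0) => i; rewrite subrr !mul0r addr0. Qed.

Lemma ord6E (i : 'I_6) :
  [\/ i = rS0, i = rE1 | i = rT1] \/ [\/ i = rS1, i = rE2 | i = rT0].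
Proof.
case: i => [[|[|[|[|[|[|m]]]]]] Hm] //.
- by left; constructor 1; apply: val_inj.
- by left; constructor 2; apply: val_inj.
- by left; constructor 3; apply: val_inj.
- by right; constructor 1; apply: val_inj.
- by right; constructor 2; apply: val_inj.
- by right; constructor 3; apply: val_inj.
Qed.

Lemma zeros_in_cone (y : cpt) : coxpt y ->
  exists k l : 'I_6, l = (k.+1 %% 6)%N :> nat /\
    forall i, i != k -> i != l -> y i != 0.
Proof.
move=> Hy.
have H : forall i j : 'I_6, i != j -> ~~ neighbours i j -> y i = 0 -> y j != 0.
  by move=> i j ne na y0; have := Hy i j ne na; rewrite y0 eqxx.
have done1 k : y k = 0 -> (exists k l : 'I_6, l = (k.+1 %% 6)%N :> nat /\
    forall i, i != k -> i != l -> y i != 0).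
  move=> yk.
  pose l : 'I_6 := inord (k.+1 %% 6); pose m : 'I_6 := inord ((k + 5) %% 6).
  have vl : l = (k.+1 %% 6)%N :> nat by rewrite inordK // ltn_mod.
  have vm : m = ((k + 5) %% 6)%N :> nat by rewrite inordK // ltn_mod.
  case: (eqVneq (y l) 0) => yl.
    exists k, l; split=> // i ik il.
    case: (boolP (neighbours k i)) => a; last by apply: (H k); rewrite // eq_sym.
    apply: (H l) => //; first by rewrite eq_sym.
    move: a ik il; rewrite -!val_eqE /neighbours /= vl.
    case: k {yk vl vm yl l m} => k /= Hk; case: i => i /= Hi.
    by move: k i Hk Hi => [|[|[|[|[|[|k]]]]]] [|[|[|[|[|[|i]]]]]].
  exists m, k; split.
    by rewrite vm; case: k {yk vl vm yl l m} => [[|[|[|[|[|[|k]]]]]] Hk].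
  move=> i im ik.
  case: (eqVneq i l) => [->//|il].
  apply: (H k) => //; first by rewrite eq_sym.
  move: im ik il; rewrite -!val_eqE /neighbours /= vl vm.
  case: k {yk vl vm yl l m} => k /= Hk; case: i => i /= Hi.
  by move: k i Hk Hi => [|[|[|[|[|[|k]]]]]] [|[|[|[|[|[|i]]]]]].
case: (pselect (exists k, y k = 0)) => [[k yk]|nex]; first exact: done1 yk.
exists rS0, rE1; split=> // i _ _; apply/eqP => yi; apply: nex; by exists i.
Qed.

Lemma globally_generated_crit (A : toric_div) :
  (forall k l : 'I_6, l = (k.+1 %% 6)%N :> nat -> exists u : int * int,
    (forall i, 0 <= A i + u.1 * (ray i).1 + u.2 * (ray i).2) /\
    A k + u.1 * (ray k).1 + u.2 * (ray k).2 = 0 /\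
    A l + u.1 * (ray l).1 + u.2 * (ray l).2 = 0) ->
  globally_generated A.
Proof.
move=> HA y /zeros_in_cone [k [l [kl Hy]]].
have [u [u0 [uk ul]]] := HA k l kl.
pose m : 'X_{1..6} := [multinom absz (A i + u.1 * (ray i).1 + u.2 * (ray i).2)%R | i < 6].
have mE i : (m i)%:Z = A i + u.1 * (ray i).1 + u.2 * (ray i).2.
  by rewrite mnmE gez0_abs.
exists 'X_[m]; split.
  move=> m'; rewrite msuppX inE => /eqP ->; exists u => i.
  by rewrite /monomial_div ffunE mE; move: (_ * _) (_ * _) => a b; lia.
rewrite mevalX; apply/prodf_neq0 => i _.
case: (eqVneq i k) => [->|ik].
  have -> : m k = 0%N by have := mE k; rewrite uk; lia.
  by rewrite expr0 oner_neq0.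
case: (eqVneq i l) => [->|il].
  have -> : m l = 0%N by have := mE l; rewrite ul; lia.
  by rewrite expr0 oner_neq0.
by rewrite expf_neq0 // Hy.
Qed.

Lemma anticanonicalE i : anticanonical i = 1.
Proof.
rewrite /anticanonical sum_ffunE (bigD1 i) //= !ffunE eqxx big1 ?addr0 // => j ji.
by rewrite ffunE eq_sym (negbTE ji).
Qed.

Lemma globally_generated_large (A : toric_div) (n : nat) :
  (forall i, 3 * `|A i| <= n%:Z) ->
  globally_generated (A + anticanonical *+ n).
Proof.
move=> Hn; apply: globally_generated_crit => k l kl.
have E i : (A + anticanonical *+ n) i = A i + n%:Z.
  by rewrite !ffunE ffunMnE anticanonicalE natz.
have h0 := Hn rS0; have h1 := Hn rE1; have h2 := Hn rT1.
have h3 := Hn rS1; have h4 := Hn rE2; have h5 := Hn rT0.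
set a0 := A rS0 in h0; set a1 := A rE1 in h1; set a2 := A rT1 in h2.
set a3 := A rS1 in h3; set a4 := A rE2 in h4; set a5 := A rT0 in h5.
case: (ord6E k) => [] [] ek; rewrite {}ek in kl *.
- rewrite (_ : l = rE1); last exact: val_inj.
  exists (- (a0 + n%:Z), a1 - a0); rewrite !E; split; last by rewrite /ray /= -/a0 -/a1; lia.
  by move=> i; case: (ord6E i) => [] [] ->; rewrite E /ray /= -/a0 -/a1 -/a2 -/a3 -/a4 -/a5; lia.
- rewrite (_ : l = rT1); last exact: val_inj.
  exists (a2 - a1, a2 + n%:Z); rewrite !E; split; last by rewrite /ray /= -/a1 -/a2; lia.
  by move=> i; case: (ord6E i) => [] [] ->; rewrite E /ray /= -/a0 -/a1 -/a2 -/a3 -/a4 -/a5; lia.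
- rewrite (_ : l = rS1); last exact: val_inj.
  exists (a3 + n%:Z, a2 + n%:Z); rewrite !E; split; last by rewrite /ray /= -/a2 -/a3; lia.
  by move=> i; case: (ord6E i) => [] [] ->; rewrite E /ray /= -/a0 -/a1 -/a2 -/a3 -/a4 -/a5; lia.
- rewrite (_ : l = rE2); last exact: val_inj.
  exists (a3 + n%:Z, a3 - a4); rewrite !E; split; last by rewrite /ray /= -/a3 -/a4; lia.
  by move=> i; case: (ord6E i) => [] [] ->; rewrite E /ray /= -/a0 -/a1 -/a2 -/a3 -/a4 -/a5; lia.
- rewrite (_ : l = rT0); last exact: val_inj.
  exists (a4 - a5, - (a5 + n%:Z)); rewrite !E; split; last by rewrite /ray /= -/a4 -/a5; lia.
  by move=> i; case: (ord6E i) => [] [] ->; rewrite E /ray /= -/a0 -/a1 -/a2 -/a3 -/a4 -/a5; lia.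
- rewrite (_ : l = rS0); last exact: val_inj.
  exists (- (a0 + n%:Z), - (a5 + n%:Z)); rewrite !E; split; last by rewrite /ray /= -/a0 -/a5; lia.
  by move=> i; case: (ord6E i) => [] [] ->; rewrite E /ray /= -/a0 -/a1 -/a2 -/a3 -/a4 -/a5; lia.
Qed.

Lemma weil_height_exists (A : toric_div) : exists H, weil_height A H.
Proof.
pose n := (\sum_i 3 * absz (A i))%N.
have Hn i : 3 * `|A i| <= n%:Z.
  have : (3 * absz (A i) <= n)%N by rewrite /n (bigD1 i) //= leq_addr.
  lia.
exists (fun y => section_height (A + anticanonical *+ n) y /
                 section_height (0 + anticanonical *+ n) y).
exists (A + anticanonical *+ n), (0 + anticanonical *+ n); split.
- exact: globally_generated_large.
- by apply: globally_generated_large => i; rewrite ffunE normr0 mulr0.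
- by rewrite add0r addrK; apply: lineq_refl.
- by exists 1; split=> // y _; rewrite invr1 !mul1r lexx.
Qed.
Lemma prod6E (T : comNzRingType) (F : 'I_6 -> T) :
  \prod_i F i = F rS0 * F rE1 * F rT1 * F rS1 * F rE2 * F rT0.
Proof.
rewrite !big_ord_recl big_ord0 mulr1 !mulrA.
by do 5?[congr (_ * _)]; congr F; apply: val_inj.
Qed.

Lemma log_anticanonicalE i :
  log_anticanonical i = ((i != rS0) && (i != rT0))%:R.
Proof.
rewrite /log_anticanonical /classD /O11 !ffunE anticanonicalE.
by case: (ord6E i) => [] [] ->.
Qed.

Definition chi (k : 'I_2 * 'I_2) : int * int := ((k.1 == 0)%:R, (k.2 == 0)%:R).

Lemma ord2E (i : 'I_2) : i = 0 \/ i = 1.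
Proof.
by case: i => [[|[|m]] Hm] //; [left|right]; apply: val_inj.
Qed.

Lemma chiE (k : 'I_2 * 'I_2) (y : 'I_6 -> R) (m : 'X_{1..6}) :
  (forall i, (m i)%:Z - log_anticanonical i
     = (chi k).1 * (ray i).1 + (chi k).2 * (ray i).2) ->
  \prod_i y i ^+ m i = coordS y k.1 * coordT y k.2.
Proof.
move=> Hm; rewrite prod6E.
have h0 := Hm rS0; have h1 := Hm rE1; have h2 := Hm rT1.
have h3 := Hm rS1; have h4 := Hm rE2; have h5 := Hm rT0.
move: h0 h1 h2 h3 h4 h5; rewrite !log_anticanonicalE /ray /chi /coordS /coordT.
case: k {Hm} => k l; case: (ord2E k) => ->; case: (ord2E l) => -> /= h0 h1 h2 h3 h4 h5.
- have [-> -> -> [-> -> ->]] : [/\ m rS0 = 1, m rE1 = 1, m rT1 = 0 & [/\ m rS1 = 0, m rE2 = 1 & m rT0 = 1]]%N by split; [lia..|split; lia].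
  by rewrite !expr1 !expr0; ring.
- have [-> -> -> [-> -> ->]] : [/\ m rS0 = 1, m rE1 = 2, m rT1 = 1 & [/\ m rS1 = 0, m rE2 = 0 & m rT0 = 0]]%N by split; [lia..|split; lia].
  by rewrite !expr1 !expr0; ring.
- have [-> -> -> [-> -> ->]] : [/\ m rS0 = 0, m rE1 = 0, m rT1 = 0 & [/\ m rS1 = 1, m rE2 = 2 & m rT0 = 1]]%N by split; [lia..|split; lia].
  by rewrite !expr1 !expr0; ring.
- have [-> -> -> [-> -> ->]] : [/\ m rS0 = 0, m rE1 = 1, m rT1 = 1 & [/\ m rS1 = 1, m rE2 = 1 & m rT0 = 0]]%N by split; [lia..|split; lia].
  by rewrite !expr1 !expr0; ring.
Qed.

Lemma globally_generated_log : globally_generated log_anticanonical.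
Proof.
apply: globally_generated_crit => k l kl.
case: (ord6E k) => [] [] ek; rewrite {}ek in kl *.
- rewrite (_ : l = rE1); last exact: val_inj.
  exists (0, 1); rewrite !log_anticanonicalE; split=> // i.
  by case: (ord6E i) => [] [] ->; rewrite log_anticanonicalE.
- rewrite (_ : l = rT1); last exact: val_inj.
  exists (0, 1); rewrite !log_anticanonicalE; split=> // i.
  by case: (ord6E i) => [] [] ->; rewrite log_anticanonicalE.
- rewrite (_ : l = rS1); last exact: val_inj.
  exists (1, 1); rewrite !log_anticanonicalE; split=> // i.
  by case: (ord6E i) => [] [] ->; rewrite log_anticanonicalE.
- rewrite (_ : l = rE2); last exact: val_inj.
  exists (1, 0); rewrite !log_anticanonicalE; split=> // i.
  by case: (ord6E i) => [] [] ->; rewrite log_anticanonicalE.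
- rewrite (_ : l = rT0); last exact: val_inj.
  exists (1, 0); rewrite !log_anticanonicalE; split=> // i.
  by case: (ord6E i) => [] [] ->; rewrite log_anticanonicalE.
- rewrite (_ : l = rS0); last exact: val_inj.
  exists (0, 0); rewrite !log_anticanonicalE; split=> // i.
  by case: (ord6E i) => [] [] ->; rewrite log_anticanonicalE.
Qed.

Lemma section_height0 y : section_height 0 y = 1.
Proof.
rewrite /section_height -[RHS](@sup1 R); congr sup.
apply/seteqP; split => h /=.
  move=> [m [[u Hu] ->]].
  have h0 := Hu rS0; have h1 := Hu rE1; have h2 := Hu rT1.
  have h3 := Hu rS1; have h4 := Hu rE2; have h5 := Hu rT0.
  rewrite prod6E; move: h0 h1 h2 h3 h4 h5; rewrite /ray /monomial_div !ffunE /=.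
  move=> h0 h1 h2 h3 h4 h5.
  have [-> -> -> [-> -> ->]] : [/\ m rS0 = 0, m rE1 = 0, m rT1 = 0 & [/\ m rS1 = 0, m rE2 = 0 & m rT0 = 0]]%N by split; [lia..|split; lia].
  by rewrite !expr0 !mulr1 normr1.
move=> ->; exists 0%MM; split.
  by exists (0, 0) => i; rewrite !ffunE mnm0E subrr !mul0r addr0.
by rewrite big1 ?normr1 // => i _; rewrite mnm0E expr0.
Qed.

Lemma section_height_log y :
  section_height log_anticanonical y =
  \big[Num.max/0]_(k : 'I_2 * 'I_2)
       `|coordS (ofZ R y) k.1 * coordT (ofZ R y) k.2|.
Proof.
set b := \big[_/_]_k _.
rewrite /section_height; set E := (X in sup X = _).
have Eb : ubound E b.
  move=> h [m [[u Hu] ->]].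
  pose k : 'I_2 * 'I_2 := (if u.1 == 1 then 0 else 1, if u.2 == 1 then 0 else 1).
  rewrite (@chiE k); first exact: le_bigmax.
  have h0 := Hu rS0; have h1 := Hu rE1; have h2 := Hu rT1.
  have h3 := Hu rS1; have h4 := Hu rE2; have h5 := Hu rT0.
  have -> : chi k = u.
    move: h0 h1 h2 h3 h4 h5; rewrite !log_anticanonicalE /ray /monomial_div !ffunE /=.
    case: u @k {Hu} => i j /= h0 h1 h2 h3 h4 h5; rewrite /chi /=.
    have [->|->] : i = 0 \/ i = 1 by lia.
      have [->|->] : j = 0 \/ j = 1 by lia.
        by [].
      by [].
    have [->|->] : j = 0 \/ j = 1 by lia.
      by [].
    by [].
  by move=> i; rewrite -Hu [monomial_div m i]ffunE.
have Ek k : E `|coordS (ofZ R y) k.1 * coordT (ofZ R y) k.2|.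
  pose m : 'X_{1..6} := [multinom absz (log_anticanonical i +
     ((chi k).1 * (ray i).1 + (chi k).2 * (ray i).2))%R | i < 6].
  have mE i : (m i)%:Z - log_anticanonical i
     = (chi k).1 * (ray i).1 + (chi k).2 * (ray i).2.
    rewrite mnmE gez0_abs ?log_anticanonicalE; first by rewrite addrC addKr.
    case: k {m} => k l.
    by case: (ord2E k) => ->; case: (ord2E l) => ->; case: (ord6E i) => [] [] ->.
  exists m; split; last by rewrite (chiE _ mE).
  by exists (chi k) => i; rewrite -mE [monomial_div m i]ffunE.
apply/le_anti/andP; split.
  by apply: ge_sup => //; exists `|coordS (ofZ R y) 0 * coordT (ofZ R y) 0|; exact: (Ek (0, 0)).
apply: bigmax_le => [|k _].
  apply: le_trans (normr_ge0 (coordS (ofZ R y) 0 * coordT (ofZ R y) 0)) _.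
  by apply: ub_le_sup; [exists b|exact: (Ek (0, 0))].
by apply: ub_le_sup; [exists b|exact: Ek].
Qed.

Lemma weil_height_log_anticanonical :
  weil_height log_anticanonical (fun y =>
    \big[Num.max/0]_(k : 'I_2 * 'I_2)
       `|coordS (ofZ R y) k.1 * coordT (ofZ R y) k.2|).
Proof.
exists log_anticanonical, 0; split.
- exact: globally_generated_log.
- apply: globally_generated_crit => k l _; exists (0, 0).
  by split=> [i|]; rewrite !ffunE !mul0r !addr0.
- by rewrite subr0; apply: lineq_refl.
- exists 1; split=> // y _.
  by rewrite section_height0 section_height_log divr1 invr1 !mul1r lexx.
Qed.
End Geometry.

Arguments globally_generated R A : clear implicits.
Arguments very_ample R A : clear implicits.
Arguments ample R A : clear implicits.
Arguments curveD R _ : clear implicits.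
Arguments lineL R k : clear implicits.
Arguments minimal_stratum R Z : clear implicits.
Arguments rational_curve R Y : clear implicits.
Arguments log_rational R Y : clear implicits.
Arguments toroidal R Y : clear implicits.
Arguments weil_height R A H : clear implicits.

(* the point ([1:1], [1:1]) *)
Definition pt_x : 'I_6 -> int := fun=> 1.

(* Main.v *)
Require Import Defs.
From HB Require Import structures.
From mathcomp Require Import all_boot all_order all_algebra.
From mathcomp Require Import mpoly.
From mathcomp Require Import complex.
From mathcomp Require Import boolp classical_sets reals constructive_ereal.
From mathcomp Require Import ereal topology normedtype sequences exp.
From mathcomp Require Import zify ring lra.

Set Implicit Arguments.
Unset Strict Implicit.
Unset Printing Implicit Defensive.

Import Order.TTheory GRing.Theory Num.Theory numFieldNormedType.Exports.
Local Open Scope classical_set_scope.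
Local Open Scope ring_scope.

(** In the Cox coordinates y the curve D has the equation
   y rS0 * y rT0 = y rT1 * y rS1, and a point is integral on U iff the two sides
   of this equation differ by 1 in absolute value ([integralU_det],
   [det_integralU]).  For p on D the four coordinates which occur are units, and
   y rE1, y rE2 at p are coprime, with p on an exceptional curve iff one of them
   is zero.

   Upper bound.  Multiply one coordinate on each side of the equation, at p, by
   parameters a and b.  If the degrees balance, this is a rational curve
   through p on which the equation of D restricts to a - b up to sign; so it
   meets D only in p, it is log rational ([line_log_rational]), and its points
   with a = N + 1 and b = N are integral.  Four such curves are used: the lines
   on which [s] or [t] is constant, if p is on no exceptional curve, and
   otherwise the exceptional curve through p.  Along a line of degree e with
   respect to L, the distance to p is of order 1/N and the height of order N^e,
   whence alpha <= e ([alpha_line_le]).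

   Lower bound.  Write the coordinates of a point as the product of an element
   of the Neron-Severi torus and of factors which remain bounded near p, and
   bounded away from zero where p has a nonzero coordinate.  All monomials of one
   class are multiplied by the same character of the torus, so the height of
   every line bundle is this character, up to a bounded factor
   ([weil_height_compare]).  Thus log H is a linear form in the logarithms of the
   torus element.  If d is the distance of an integral point from p, then
   u1/u0 differs from its value 1 at p by 1/|u0|, and s0/s1 and t1/t0 differ from
   their values at p by at least a constant over |s1| and |t0|, unless the point
   is on one of the lines.  This bounds the logarithm of 1/d by the linear forms
   of the conic classes.  When L is nef, log H is a combination of these and of
   forms bounded below, with the intersection numbers of L and the six boundary
   curves as coefficients ([log_weight_chart]); so H is at least d^-e up to a
   constant, where e is the minimal degree of the lines through p
   ([height_lower]).

   Hence alpha is e for the set of all integral points, and equally for each of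
   its subsets which contains the sequence on a line of minimal degree
   ([alpha_line]).  At x both lines have degree 1 with respect to O(1,1). *)

(** * Integral points *)

Lemma sum6E (V : nmodType) (F : 'I_6 -> V) :
  \sum_i F i = F rS0 + F rE1 + F rT1 + F rS1 + F rE2 + F rT0.
Proof.
rewrite !big_ord_recl big_ord0 addr0 !addrA.
by do 5?[congr (_ + _)]; congr F; apply: val_inj.
Qed.

(** The torus Hom(Pic X, Gm) consists of the scalings for which both
   coordinates [s0 : s1] and [t0 : t1] are unchanged. *)
Lemma torus_relations (K : fieldType) (l : 'I_6 -> K) :
  (forall i, l i != 0) ->
  \prod_i l i ^ (ray i).1 = 1 -> \prod_i l i ^ (ray i).2 = 1 ->
  l rS0 * l rE1 = l rS1 * l rE2 /\ l rT0 * l rE2 = l rT1 * l rE1.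
Proof.
move=> l0; rewrite !prod6E /ray /= !exprN1 !expr1z !expr0z !mulr1 !mul1r.
move=> h1 h2; split.
  rewrite -[RHS]mul1r -h1; field; by rewrite !l0.
rewrite -[RHS]mul1r -h2; field; by rewrite !l0.
Qed.

Lemma meval_map_mpoly (n : nat) (A B : comNzRingType) (f : {rmorphism A -> B})
    (P : {mpoly A[n]}) (y : 'I_n -> A) :
  (map_mpoly f P).@[f \o y] = f P.@[y].
Proof.
rewrite [P.@[y]]mevalE /map_mpoly {1}/mmap !rmorph_sum /=; apply: eq_bigr => m _.
rewrite mevalM mevalC rmorphM /mmap1 !rmorph_prod; congr (_ * _).
by apply: eq_bigr => i _; rewrite !rmorphXn /= mevalXU.
Qed.

Section Boundary.
Variable R : realType.
Local Notation C := R[i].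

Definition detform (T : nzRingType) : {mpoly T[6]} :=
  'X_rS0 * 'X_rT0 - 'X_rT1 * 'X_rS1.

Lemma detform_homog (T : nzRingType) : form_of (bdiv rS0 + bdiv rT0) (detform T).
Proof.
move=> m /msuppB_le; rewrite mem_cat -!mpolyXD !msuppX !inE => /orP [] /eqP ->.
  by exists (0, 0) => i; case: (ord6E i) => [] [] ->; rewrite !ffunE mnmDE !mnm1E.
by exists (-1, -1) => i; case: (ord6E i) => [] [] ->; rewrite !ffunE mnmDE !mnm1E.
Qed.

Lemma detform_eval (T : comNzRingType) (y : 'I_6 -> T) :
  (detform T).@[y] = y rS0 * y rT0 - y rT1 * y rS1.
Proof. by rewrite /detform mevalB !mevalM !mevalXU. Qed.

Lemma curveD_eq (z : 'I_6 -> C) :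
  curveD R z -> z rS0 * z rT0 = z rT1 * z rS1.
Proof.
case=> _ /(_ _ _ (@detform_homog C)); rewrite detform_eval => H.
apply/eqP; rewrite -subr_eq0; apply/eqP; apply: H => y [_ + h1 h2].
rewrite detform_eval /coordS /coordT /= in h1 h2 * => e.
have nz : y rE1 * y rE2 != 0.
  apply/negP; rewrite mulf_eq0 => /orP [] /eqP e0.
    by apply: h1; rewrite e0 !mulr0.
  by apply: h2; rewrite e0 !mulr0.
apply: (mulfI nz); rewrite mulr0.
transitivity (y rS0 * y rE1 * (y rT0 * y rE2) - y rS1 * y rE2 * (y rT1 * y rE1)).
  by ring.
by rewrite e subrr.
Qed.

Lemma zclosure_sub (Z : set ('I_6 -> C)) y : coxpt y -> Z y -> zclosure Z y.
Proof. by move=> cy Zy; split=> // A P _; apply. Qed.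

(** A point of the torus does not lie over z1 or z2, so it need not be approached
   by other points of D. *)
Lemma curveD_torus (z : 'I_6 -> C) :
  (forall i, z i != 0) -> z rS0 * z rT0 = z rT1 * z rS1 -> curveD R z.
Proof.
move=> z0 e; have cz : coxpt z by move=> i j _ _; rewrite z0.
apply: zclosure_sub => //; split=> //; rewrite /coordS /coordT /=.
- transitivity (z rS0 * z rT0 * (z rE1 * z rE2)); first by ring.
  by rewrite e; ring.
- by case=> /eqP; rewrite mulf_eq0 !(negbTE (z0 _)).
- by case=> /eqP; rewrite mulf_eq0 !(negbTE (z0 _)).
Qed.

Lemma meval_intr (T : comNzRingType) (P : {mpoly int[6]}) (y : 'I_6 -> int) :
  (map_mpoly (intr : int -> T) P).@[fun i => (y i)%:~R] = (P.@[y])%:~R.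
Proof. exact: (meval_map_mpoly (intr : {rmorphism int -> T})). Qed.

(** Let a prime p divide the difference.  Then p does not divide y rS0, so y is
   congruent modulo p to an integral point v with nonzero coordinates which
   satisfies the equation of D.  All forms in the ideal of D are zero at v, so
   they are divisible by p at y, which contradicts integrality at p. *)
Lemma integralU_det (y : 'I_6 -> int) :
  integralU R y -> `|y rS0 * y rT0 - y rT1 * y rS1| = 1.
Proof.
case=> zy _ H; set d := (X in `|X|).
case: (eqVneq (absz d) 1%N) => [d1|d1]; first by lia.
have [p pr pd] : exists2 p : nat, prime p & (p%:Z %| d)%Z.
  case: (eqVneq (absz d) 0%N) => [d0|d0].
    by exists 2%N => //; rewrite dvdzE d0 dvdn0.
  exists (pdiv (absz d)); first by apply: pdiv_prime; lia.
  by rewrite dvdzE /= pdiv_dvd.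
exfalso; apply: (H p pr) => P [_ PD].
have chp := pchar_Fp pr.
have dvdF n : (p%:Z %| n)%Z = (n%:~R == 0 :> 'F_p) by exact: dvdz_pcharf.
have p0 : p != 0%N by case: (p) pr.
have pn1 : ~~ (p%:Z %| 1)%Z by rewrite dvdzE /= dvdn1; case: (p) pr => [|[]].
(* otherwise p would also divide y rT1 or y rS1, to which y rS0 is coprime *)
have y0 : (y rS0)%:~R != 0 :> 'F_p.
  rewrite -dvdF; apply/negP => p0y.
  have : (p%:Z %| y rT1 * y rS1)%Z.
    have -> : y rT1 * y rS1 = y rS0 * y rT0 - d by rewrite /d; ring.
    by rewrite rpredB ?dvdz_mulr.
  have cop j : coprimez (y rS0) (y j) -> ~~ (p%:Z %| y j)%Z.
    move=> /eqP c; apply: contra pn1 => pj.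
    by have := dvdz_gcd p (y rS0) (y j); rewrite c p0y pj.
  move: (cop rT1) (cop rS1); rewrite !dvdF rmorphM mulf_eq0.
  move=> /(_ (zy rS0 rT1 isT isT)) /negbTE -> /(_ (zy rS0 rS1 isT isT)) /negbTE ->.
  by [].
(* w makes a representative nonzero without changing its residue class *)
pose w (n : int) : int := if n == 0 then p%:Z else n.
have w0 n : w n != 0 by rewrite /w; case: ifPn.
have wF n : (w n)%:~R = n%:~R :> 'F_p.
  by rewrite /w; case: eqP => // ->; apply/eqP; rewrite -dvdF dvdzz.
have [u uF] : exists u : int, u%:~R = ((y rS0)%:~R)^-1 :> 'F_p.
  by exists (Posz ((y rS0)%:~R^-1 : 'F_p)); rewrite -[RHS]natr_Zp.
(* q is y rS1 / y rS0 modulo p, and y rT0 is y rT1 * q modulo p *)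
pose q := w (u * y rS1).
pose v (i : 'I_6) : int := if i == rS1 then w (y rS0) * q else
  if i == rT0 then w (y rT1) * q else w (y i).
have v0 i : v i != 0.
  by rewrite /v /q; case: ifP => _; [|case: ifP => _]; rewrite ?mulf_eq0 ?negb_or ?w0.
have vF i : (v i)%:~R = (y i)%:~R :> 'F_p.
  rewrite /v /q; case: eqP => [->|_]; first by rewrite intrM !wF intrM uF mulVKf.
  case: eqP => [->|_]; last by rewrite wF.
  rewrite intrM !wF intrM uF mulrCA -intrM.
  have -> : y rT1 * y rS1 = y rS0 * y rT0 - d by rewrite /d; ring.
  rewrite intrB intrM; move: pd; rewrite dvdF => /eqP ->.
  by rewrite subr0 mulKf.
have : P.@[v] = 0.
  have := PD (ofZ C v); rewrite meval_intr => h; apply/eqP.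
  rewrite -(intr_eq0 C); apply/eqP/h; apply: curveD_torus => [i|].
    by rewrite intr_eq0.
  by rewrite /ofZ -!rmorphM /v /=; congr (_%:~R); ring.
move=> /(congr1 (intr : int -> 'F_p)); rewrite -meval_intr dvdF -meval_intr rmorph0.
by move=> <-; apply/eqP/meval_eq => i; rewrite vF.
Qed.

Lemma det_integralU (y : 'I_6 -> int) :
  zpt y -> `|y rS0 * y rT0 - y rT1 * y rS1| = 1 -> integralU R y.
Proof.
move=> zy d1; split=> //.
  move=> /curveD_eq /eqP; rewrite /ofZ -!rmorphM /= eqr_int => /eqP e.
  by move: d1; rewrite e subrr.
move=> p pr /(_ (detform int)); rewrite detform_eval dvdzE => h.
have : (p %| 1)%N.
  have -> : 1%N = absz (y rS0 * y rT0 - y rT1 * y rS1)%R by lia.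
  apply: h; split; first by exists (bdiv rS0 + bdiv rT0); apply: detform_homog.
  move=> z /curveD_eq e.
  by rewrite /detform rmorphB !rmorphM /= !map_mpolyX !mevalB !mevalM !mevalXU e subrr.
by rewrite dvdn1; case: (p) pr => [|[]].
Qed.

(** Each of these coordinates divides the product of two coordinates to which it
   is coprime. *)
Lemma unit_of_curveD (p : 'I_6 -> int) :
  zpt p -> p rS0 * p rT0 = p rT1 * p rS1 ->
  [/\ `|p rS0| = 1, `|p rT0| = 1, `|p rT1| = 1 & `|p rS1| = 1].
Proof.
move=> zp e.
have aux (a b c d : int) : coprimez a c -> coprimez a d -> a * b = c * d -> `|a| = 1.
  move=> ac ad e1; have : (a %| 1)%Z.
    have h : coprimez a (c * d) by rewrite coprimezMr ac.
    by have := dvdz_gcd a a (c * d); rewrite (eqP h) dvdzz -e1 dvdz_mulr.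
  by rewrite dvdzE dvdn1 => /eqP; lia.
have c i j : i != j -> ~~ neighbours i j -> coprimez (p i) (p j) by exact: zp.
split.
- exact: aux (c rS0 rT1 isT isT) (c rS0 rS1 isT isT) e.
- by apply: aux (c rT0 rT1 isT isT) (c rT0 rS1 isT isT) _; rewrite mulrC; exact: e.
- exact: aux (c rT1 rS0 isT isT) (c rT1 rT0 isT isT) (esym e).
- by apply: aux (c rS1 rS0 isT isT) (c rS1 rT0 isT isT) _; rewrite mulrC; exact: (esym e).
Qed.

Lemma zpt_coxpt (K : numFieldType) (y : 'I_6 -> int) : zpt y -> coxpt (ofZ K y).
Proof.
move=> zy i j ne na; rewrite /ofZ !intr_eq0 -negb_and; apply/negP => /andP [/eqP i0 /eqP j0].
by have := zy i j ne na; rewrite i0 j0.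
Qed.

End Boundary.

(** * Heights near a boundary point *)

Section Heights.
Variable R : realType.
Local Notation C := R[i].

(** The class of A in Pic X paired with the logarithm w of a torus element. *)
Definition log_weight (A : toric_div) (w : 'I_6 -> R) : R := \sum_i (A i)%:~R * w i.

Definition torus_log (w : 'I_6 -> R) : Prop :=
  w rS0 + w rE1 = w rS1 + w rE2 /\ w rT0 + w rE2 = w rT1 + w rE1.

Lemma log_weight_lineq (A B : toric_div) (w : 'I_6 -> R) :
  lineq A B -> torus_log w -> log_weight A w = log_weight B w.
Proof.
move=> [u Hu] [w1 w2].
have E i : (A i)%:~R = (B i)%:~R + (u.1)%:~R * ((ray i).1)%:~R
    + (u.2)%:~R * ((ray i).2)%:~R :> R.
  by rewrite -!intrM -!intrD -addrA -Hu addrC subrK.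
rewrite /log_weight !sum6E.
have -> : w rS1 = w rS0 + w rE1 - w rE2 by rewrite w1 addrK.
have -> : w rT1 = w rT0 + w rE2 - w rE1 by rewrite w2 addrK.
by rewrite !E /ray /=; ring.
Qed.

Lemma log_weightB (A B : toric_div) (w : 'I_6 -> R) :
  log_weight (A - B) w = log_weight A w - log_weight B w.
Proof.
by rewrite /log_weight -sumrB; apply: eq_bigr => i _; rewrite !ffunE intrB mulrBl.
Qed.

Lemma monomial_log (B : toric_div) (m : 'X_{1..6}) (w v : 'I_6 -> R) :
  lineq (monomial_div m) B -> torus_log w ->
  \prod_i (expR (w i) * v i) ^+ m i = expR (log_weight B w) * \prod_i v i ^+ m i.
Proof.
move=> /log_weight_lineq h /h <-; rewrite /log_weight expR_sum -big_split /=.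
apply: eq_bigr => i _; rewrite exprMn; congr (_ * _).
by rewrite ffunE -expRM_natl.
Qed.

(** Opposite rays are negatives of each other, so the exponents of the
   coordinates k and k + 3 have a sum that depends on B only. *)
Lemma lineq_monomial_bound (B : toric_div) (m : 'X_{1..6}) (i : 'I_6) :
  lineq (monomial_div m) B -> (m i <= \sum_j absz (B j))%N.
Proof.
case=> u Hu.
have h0 := Hu rS0; have h1 := Hu rE1; have h2 := Hu rT1.
have h3 := Hu rS1; have h4 := Hu rE2; have h5 := Hu rT0.
move: h0 h1 h2 h3 h4 h5; rewrite sum6E /ray /monomial_div !ffunE /=.
by case: (ord6E i) => [] [] -> *; lia.
Qed.

Lemma globally_generated_monomial (B : toric_div) (y : 'I_6 -> C) :
  globally_generated R B -> coxpt y ->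
  exists m : 'X_{1..6}, lineq (monomial_div m) B /\ forall i, y i = 0 -> m i = 0%N.
Proof.
move=> ggB /ggB [P [PB Py]].
have [m mP] : exists2 m, m \in msupp P & \prod_i y i ^+ m i != 0.
  apply/hasP; apply: contraNT Py => /hasPn h.
  rewrite mevalE big_seq big1 // => m /h; rewrite negbK => /eqP ->.
  by rewrite mulr0.
move=> /prodf_neq0 h; exists m; split; first exact: PB.
move=> i yi; have := h i isT; rewrite yi expr0n; case: (m i) => // n.
by rewrite eqxx.
Qed.

(** The torus element acts on all sections of one class through the same scalar;
   the remaining factors v keep all monomials bounded, and bound from below one
   monomial which is nonzero at p. *)
Lemma section_height_compare (p : 'I_6 -> C) (B : toric_div) (K k : R) :
  globally_generated R B -> coxpt p -> 0 < k ->
  exists c : R, 0 < c /\ forall (y : 'I_6 -> int) (w v : 'I_6 -> R),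
    torus_log w -> (forall i, `|(y i)%:~R| = expR (w i) * v i) ->
    (forall i, 0 <= v i <= K) -> (forall i, p i != 0 -> k <= v i) ->
    c^-1 * expR (log_weight B w) <= section_height R B y <= c * expR (log_weight B w).
Proof.
move=> ggB cp k0.
have [m0 [m0B m0p]] := globally_generated_monomial ggB cp.
pose D := (\sum_j absz (B j))%N; pose K1 := Num.max 1 K.
have K11 : 1 <= K1 by rewrite le_max lexx.
have KK1 : K <= K1 by rewrite le_max lexx orbT.
pose a := \prod_i k ^+ m0 i; pose b := \prod_(i < 6) K1 ^+ D.
have a0 : 0 < a by apply: prodr_gt0 => i _; rewrite exprn_gt0.
have b0 : 0 < b by apply: prodr_gt0 => i _; rewrite exprn_gt0 ?(lt_le_trans ltr01).
(* a bounds from below the monomial m0 at v, b from above all monomials at v *)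
exists (Num.max a^-1 b); split; first by rewrite lt_max b0 orbT.
move=> y w v tw yE vK vk; set E := expR _.
have E0 : 0 < E by exact: expR_gt0.
have yM m : lineq (monomial_div m) B ->
    `|\prod_i (y i)%:~R ^+ m i| = E * \prod_i v i ^+ m i.
  move=> mB; rewrite normr_prod -(monomial_log v mB tw); apply: eq_bigr => i _.
  by rewrite normrX yE.
have v0 i : 0 <= v i by case/andP: (vK i).
have ub : ubound [set h | exists m : 'X_{1..6}, lineq (monomial_div m) B /\
    h = `|\prod_i (y i)%:~R ^+ m i|] (Num.max a^-1 b * E).
  move=> _ [m [mB ->]]; rewrite yM // mulrC ler_wpM2r ?(ltW E0) //.
  rewrite le_max; apply/orP; right; apply: ler_prod => i _.
  rewrite exprn_ge0 //=; apply: le_trans (_ : K1 ^+ m i <= _).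
    by apply: lerXn2r; rewrite ?nnegrE //; case/andP: (vK i) => v1 v2;
      rewrite ?(le_trans ler01) // (le_trans v2).
  by rewrite ler_weXn2l // lineq_monomial_bound.
apply/andP; split; last first.
  by apply: ge_sup ub; exists `|\prod_i (y i)%:~R ^+ m0 i|, m0.
apply: le_trans (_ : `|\prod_i (y i)%:~R ^+ m0 i| <= _); last first.
  by apply: ub_le_sup; [exists (Num.max a^-1 b * E) | exists m0].
rewrite yM // mulrC ler_pM2l //; apply: le_trans (_ : a <= _).
  by rewrite -[leRHS]invrK lef_pV2 ?posrE ?lt_max ?invr_gt0 ?a0 // le_max lexx.
apply: ler_prod => i _; rewrite exprn_ge0 ?(ltW k0) //=.
case: (eqVneq (p i) 0) => [/m0p ->|pi]; first by rewrite !expr0.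
by apply: lerXn2r; rewrite ?nnegrE ?(ltW k0) // vk.
Qed.

(** A Weil height is a quotient of two section heights up to bounded factors, and
   [log_weight] is additive in the class. *)
Lemma weil_height_compare (p : 'I_6 -> C) (A : toric_div)
    (H : ('I_6 -> int) -> R) (K k : R) :
  weil_height R A H -> coxpt p -> 0 < k ->
  exists c : R, 0 < c /\ forall (y : 'I_6 -> int) (w v : 'I_6 -> R), zpt y ->
    torus_log w -> (forall i, `|(y i)%:~R| = expR (w i) * v i) ->
    (forall i, 0 <= v i <= K) -> (forall i, p i != 0 -> k <= v i) ->
    c^-1 * expR (log_weight A w) <= H y <= c * expR (log_weight A w).
Proof.
move=> [B [B' [ggB ggB' AB [c [c0 HH]]]]] cp k0.
have [b [b0 Hb]] := section_height_compare K ggB cp k0.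
have [b' [b'0 Hb']] := section_height_compare K ggB' cp k0.
exists (c * b * b'); split; first by rewrite !mulr_gt0.
move=> y w v zy tw yE vK vk.
have /andP [s1 s2] := Hb y w v tw yE vK vk.
have /andP [t1 t2] := Hb' y w v tw yE vK vk.
have /andP [h1 h2] := HH y zy.
move: s1 s2 t1 t2 h1 h2.
rewrite (log_weight_lineq AB tw) log_weightB expRD expRN.
set e := expR (log_weight B w); set e' := expR (log_weight B' w).
set s := section_height R B y; set t := section_height R B' y.
have e0 : 0 < e by exact: expR_gt0.
have e'0 : 0 < e' by exact: expR_gt0.
move=> s1 s2 t1 t2 h1 h2.
have t0 : 0 < t by apply: lt_le_trans t1; rewrite mulr_gt0 ?invr_gt0.
have s0 : 0 < s by apply: lt_le_trans s1; rewrite mulr_gt0 ?invr_gt0.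
apply/andP; split.
  apply: le_trans h1; rewrite !invfM -!mulrA ler_pM2l ?invr_gt0 //.
  have -> : b^-1 * (b'^-1 * (e / e')) = b^-1 * e * (b' * e')^-1.
    by rewrite invfM; ring.
  have q0 : 0 <= b^-1 * e by rewrite mulr_ge0 ?invr_ge0 // ltW.
  apply: ler_pM => //; first by rewrite invr_ge0 mulr_ge0 // ltW.
  by rewrite lef_pV2 ?posrE ?mulr_gt0.
apply: le_trans h2 _; rewrite -!mulrA ler_pM2l //.
have -> : b * (b' * (e / e')) = b * e * (b'^-1 * e')^-1.
  by rewrite invfM invrK; ring.
apply: ler_pM => //; rewrite ?invr_ge0; [exact: ltW..|].
by rewrite lef_pV2 ?posrE ?mulr_gt0 ?invr_gt0.
Qed.

End Heights.

(** * Lines through a boundary point *)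

(** A rational curve through p, on which the coordinates [fst_ix] and [snd_ix] are
   those of p times a parameter and all others are constant.  The intersection
   numbers [line_deg] with the boundary curves are 1, 1 and 0, except that the
   curve may itself be a boundary component, where p is zero and the
   self-intersection is arbitrary.  The mates are the coordinates completing the
   moving ones to two sections of the same class; their quotient is a parameter
   of the curve, which shows that its parametrization is birational. *)
Record contact_line (p : 'I_6 -> int) := ContactLine {
  fst_ix : 'I_6;
  snd_ix : 'I_6;
  fst_mate : 'I_6;
  snd_mate : 'I_6;
  line_deg : 'I_6 -> int;
  fst_ixE : fst_ix = rS0 \/ fst_ix = rT0;
  snd_ixE : snd_ix = rT1 \/ snd_ix = rS1;
  mates_lineq : lineq (bdiv snd_ix + bdiv snd_mate) (bdiv fst_ix + bdiv fst_mate);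
  mate_fixed : [/\ fst_mate != fst_ix, fst_mate != snd_ix,
                   snd_mate != fst_ix & snd_mate != snd_ix];
  mate_neq0 : p fst_mate != 0 /\ p snd_mate != 0;
  line_deg_fst : line_deg fst_ix = 1;
  line_deg_snd : line_deg snd_ix = 1;
  line_deg_fixed : forall k, k != fst_ix -> k != snd_ix ->
    line_deg k = 0 /\ p k != 0 \/
    p k = 0 /\ neighbours k fst_ix && neighbours k snd_ix;
  line_deg_balanced : \sum_i line_deg i * (ray i).1 = 0 /\
                      \sum_i line_deg i * (ray i).2 = 0
}.

Section Lines.
Variables (R : realType) (p : 'I_6 -> int).
Local Notation C := R[i].
Hypotheses (zp : zpt p) (Dp : curveD R (ofZ C p)).
Variable l : contact_line p.

Let i := fst_ix l.
Let j := snd_ix l.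

Lemma det_of_curveD : p rS0 * p rT0 = p rT1 * p rS1.
Proof.
by apply/eqP; rewrite -(eqr_int C) !intrM; apply/eqP; exact: curveD_eq Dp.
Qed.

Lemma moving_unit k : k \in [:: rS0; rT0; rT1; rS1] -> `|p k| = 1.
Proof.
have [h0 h5 h2 h3] := unit_of_curveD zp det_of_curveD.
by rewrite !inE => /or4P [] /eqP ->.
Qed.

Lemma moving_neq0 (K : numFieldType) k :
  k \in [:: rS0; rT0; rT1; rS1] -> (p k)%:~R != 0 :> K.
Proof. by move=> /moving_unit; rewrite intr_eq0 -normr_eq0 => ->. Qed.

Lemma fst_moving : i \in [:: rS0; rT0; rT1; rS1].
Proof. by rewrite /i; case: (fst_ixE l) => ->; rewrite !inE eqxx ?orbT. Qed.

Lemma snd_moving : j \in [:: rS0; rT0; rT1; rS1].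
Proof. by rewrite /j; case: (snd_ixE l) => ->; rewrite !inE eqxx ?orbT. Qed.

Lemma fst_snd : (i == j) = false.
Proof. by rewrite /i /j; case: (fst_ixE l) => ->; case: (snd_ixE l) => ->. Qed.

Definition param_exponent (k : 'I_6) : 'X_{1..2} :=
  if k == i then U_(0%R)%MM else if k == j then U_(1%R)%MM else 0%MM.

Definition line_form (k : 'I_6) : {mpoly rat[2]} :=
  (p k)%:~R *: 'X_[param_exponent k].

Definition line_factor (T : nzRingType) (a b : T) (k : 'I_6) : T :=
  if k == i then a else if k == j then b else 1.

Lemma evalQ_term n (a : int) (m : 'X_{1..n}) (z : 'I_n -> C) :
  evalQ (a%:~R *: 'X_[m]) z = a%:~R * \prod_k z k ^+ m k.
Proof. by rewrite /evalQ map_mpolyZ mevalZ map_mpolyX mevalX /= ratr_int. Qed.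

Lemma line_formE (z : 'I_2 -> C) k :
  evalQ (line_form k) z = (p k)%:~R * line_factor (z 0) (z 1) k.
Proof.
rewrite evalQ_term /param_exponent /line_factor; congr (_ * _).
rewrite !big_ord_recl big_ord0 mulr1.
have -> : lift ord0 ord0 = 1 :> 'I_2 by apply: val_inj.
have -> : ord0 = 0 :> 'I_2 by apply: val_inj.
by do 2?[case: ifP => _]; rewrite ?mnm1E ?mnm0E ?expr1 ?expr0 ?mulr1 ?mul1r.
Qed.

Lemma line_form_homog k : binary_form (line_deg l k) (line_form k).
Proof.
rewrite /line_form /param_exponent; case: eqP => [->|/eqP ki].
  by right; exists 1%N; rewrite line_deg_fst dhomogZ // dhomogX /= mdeg1.
case: eqP => [->|/eqP kj].
  by right; exists 1%N; rewrite line_deg_snd dhomogZ // dhomogX /= mdeg1.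
case: (line_deg_fixed ki kj) => [[-> _]|[-> _]]; last by left; rewrite scale0r.
by right; exists 0%N; rewrite dhomogZ // dhomogX /= mdeg0.
Qed.

(** Where p has nonzero coordinates, nothing can vanish but one of the two
   parameters; the boundary curve containing the line, if any, is adjacent to
   both moving coordinates. *)
Lemma line_form_coxpt (z : 'I_2 -> C) : nonzero z ->
  coxpt (fun k => evalQ (line_form k) z).
Proof.
move=> z0; have {z0} z01 : (z 0 != 0) || (z 1 != 0).
  case: z0 => k; case: (ord2E k) => -> ->; by rewrite ?orbT.
have fixedP a b : a != b -> ~~ neighbours a b -> a != i -> a != j ->
    (evalQ (line_form a) z != 0) || (evalQ (line_form b) z != 0).
  move=> ab nab ai aj.
  have fixE c : c != i -> c != j -> evalQ (line_form c) z = ofZ C p c.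
    by move=> ci cj; rewrite line_formE /line_factor (negbTE ci) (negbTE cj) mulr1.
  rewrite (fixE a) //; case: (line_deg_fixed ai aj) => [[_ pa]|[_ /andP [ni nj]]].
    by rewrite /ofZ intr_eq0 pa.
  case: (eqVneq b i) nab => [->|bi nab]; first by rewrite ni.
  case: (eqVneq b j) nab => [->|bj nab]; first by rewrite nj.
  by rewrite fixE //; apply: zpt_coxpt.
have nsym a b : neighbours a b = neighbours b a by rewrite /neighbours orbC.
have fi : evalQ (line_form i) z = (p i)%:~R * z 0.
  by rewrite line_formE /line_factor eqxx.
have fj : evalQ (line_form j) z = (p j)%:~R * z 1.
  by rewrite line_formE /line_factor eqxx eq_sym fst_snd.
have pi0 := moving_neq0 C fst_moving; have pj0 := moving_neq0 C snd_moving.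
move=> a b ab nab.
case: (boolP ((a != i) && (a != j))) => [/andP [ai aj]|]; first exact: fixedP.
case: (boolP ((b != i) && (b != j))) => [/andP [bi bj] _|].
  by rewrite orbC fixedP // 1?eq_sym // nsym.
rewrite !negb_and !negbK.
move=> /orP [] /eqP bE /orP [] /eqP aE; move: ab; rewrite aE bE ?eqxx // => _;
  by rewrite fi fj !mulf_eq0 !negb_or pi0 pj0 //= orbC.
Qed.

Definition line_map : p1map R :=
  P1map line_form_homog (line_deg_balanced l).1 (line_deg_balanced l).2
    line_form_coxpt.

Definition line_curve : set ('I_6 -> C) := p1image line_map.

Lemma line_mapE z k :
  p1eval line_map z k = (p k)%:~R * line_factor (z 0) (z 1) k.
Proof. exact: line_formE. Qed.

Definition pt2 (T : Type) (a b : T) (k : 'I_2) : T := if k == 0 then a else b.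

Lemma line_map_nonconstant : nonconstant line_map.
Proof.
exists (pt2 1 0), (pt2 0 1); split.
- by exists 0; rewrite /pt2 eqxx oner_neq0.
- by exists 1; rewrite /pt2 oner_neq0.
move=> [t [_ _ _ /(_ j)]]; rewrite !line_mapE /line_factor eqxx eq_sym fst_snd /pt2 /=.
rewrite mulr0 !mulr1 mulr0; apply/eqP; exact: moving_neq0 snd_moving.
Qed.

Lemma line_rational : rational_curve R line_curve.
Proof. by exists line_map; split=> //; exact: line_map_nonconstant. Qed.

Lemma same_pt_refl (K : fieldType) (y : 'I_6 -> K) : same_pt y y.
Proof.
exists (fun=> 1); split=> [k|||k]; rewrite ?oner_neq0 ?mul1r //;
  by rewrite big1 // => k _; rewrite exp1rz.
Qed.

Lemma line_map_det z :
  p1eval line_map z rS0 * p1eval line_map z rT0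
  - p1eval line_map z rT1 * p1eval line_map z rS1
  = (p rS0 * p rT0)%:~R * (z 0 - z 1).
Proof.
have e := congr1 (intr : int -> C) det_of_curveD.
rewrite mulrBr {2}e !line_mapE /line_factor /i /j !intrM.
by case: (fst_ixE l) => ->; case: (snd_ixE l) => -> /=; ring.
Qed.

Lemma line_normalization : normalization line_map line_curve.
Proof.
split=> //; pose m1 := (U_(i) + U_(fst_mate l))%MM; pose m2 := (U_(j) + U_(snd_mate l))%MM.
have mE a b : monomial_div (U_(a) + U_(b))%MM = bdiv a + bdiv b.
  by apply/ffunP => k; rewrite !ffunE mnmDE !mnm1E PoszD !(eq_sym _ k); do 2!case: eqP.
have [m1i m1j m2i m2j] := mate_fixed l; have [n1 n2] := mate_neq0 l.
exists (bdiv i + bdiv (fst_mate l)), ((p j * p (snd_mate l))%:~R *: 'X_[m1]),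
  ((p i * p (fst_mate l))%:~R *: 'X_[m2]).
have val1 z : \prod_k p1eval line_map z k ^+ m1 k = (p i * p (fst_mate l))%:~R * z 0.
  rewrite -mevalX /m1 mpolyXD mevalM !mevalXU !line_mapE /line_factor eqxx.
  by rewrite (negbTE m1i) (negbTE m1j) intrM; ring.
have val2 z : \prod_k p1eval line_map z k ^+ m2 k = (p j * p (snd_mate l))%:~R * z 1.
  rewrite -mevalX /m2 mpolyXD mevalM !mevalXU !line_mapE /line_factor eqxx.
  by rewrite (negbTE m2i) (negbTE m2j) eq_sym fst_snd intrM; ring.
split.
- move=> m /msuppZ_le; rewrite msuppX inE => /eqP ->; rewrite mE; exact: lineq_refl.
- move=> m /msuppZ_le; rewrite msuppX inE => /eqP ->; rewrite mE; exact: mates_lineq.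
- exists (pt2 1 1); split; first by exists 0; rewrite /pt2 eqxx oner_neq0.
  rewrite evalQ_term val2 /pt2 /= mulr1 -intrM intr_eq0 !mulf_eq0 !negb_or n1 n2.
  by rewrite -!(intr_eq0 C) !moving_neq0 ?fst_moving ?snd_moving.
- by move=> z; rewrite !evalQ_term val1 val2; ring.
Qed.

(** The equation of D restricts to a linear form in the two parameters, by
   [line_map_det]. *)
Lemma line_preimageD : preimageD_degree line_map 1.
Proof.
exists (fun=> pt2 1 1); split.
- move=> _; split; first by exists 0; rewrite /pt2 eqxx oner_neq0.
  have -> // : p1eval line_map (pt2 1 1) = ofZ C p.
  apply/funext => k; rewrite line_mapE /line_factor /pt2 /=.
  by do 2?[case: ifP => _]; rewrite mulr1.
- by move=> a b _; rewrite !ord1.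
- move=> z _ /curveD_eq /eqP; rewrite -subr_eq0 line_map_det intrM !mulf_eq0.
  rewrite !(negbTE (moving_neq0 C _)) ?inE ?eqxx ?orbT //= subr_eq0 => /eqP e.
  by exists 0; rewrite /pt2 /= e.
Qed.

Lemma line_log_rational : log_rational R line_curve.
Proof.
split; first exact: line_rational.
by exists line_map, 1%N; split; [exact: line_normalization|exact: line_preimageD|].
Qed.

Definition line_pt (a b : int) (k : 'I_6) : int := p k * line_factor a b k.

Lemma line_pt_on_curve a b : (a != 0) || (b != 0) -> zpt (line_pt a b) ->
  on_curve line_curve (line_pt a b).
Proof.
move=> ab zy; split=> //; split; first exact: zpt_coxpt.
exists (pt2 a%:~R b%:~R); split.
  case/orP: ab => h; [exists 0|exists 1]; by rewrite /pt2 /= intr_eq0.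
have -> : p1eval line_map (pt2 a%:~R b%:~R) = ofZ C (line_pt a b).
  apply/funext => k; rewrite line_mapE /ofZ /line_pt intrM /line_factor /pt2 /=.
  by do 2?[case: ifP => _].
exact: same_pt_refl.
Qed.

Lemma line_pt_det a b :
  line_pt a b rS0 * line_pt a b rT0 - line_pt a b rT1 * line_pt a b rS1
  = p rS0 * p rT0 * (a - b).
Proof.
rewrite mulrBr {2}det_of_curveD /line_pt /line_factor /i /j.
by case: (fst_ixE l) => ->; case: (snd_ixE l) => -> /=; ring.
Qed.

End Lines.

(** * Upper bound along a line *)

Section Distance.
Variable R : realType.

Lemma proj_dist_ge0 (I : finType) (x y : I -> R) : 0 <= proj_dist x y.
Proof.
have bm0 (F : I -> R) : 0 <= \big[Num.max/0]_i F i by apply: bigmax_ge_id.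
by rewrite /proj_dist divr_ge0 ?mulr_ge0 // bigmax_ge_id.
Qed.

(** The distance is invariant under the scaling by e, and each of its minors
   x i * y j - x j * y i is e * x i * x j times a difference of two f. *)
Lemma proj_dist_le (I : finType) (x y f : I -> R) (e h : R) :
  0 < e -> 0 <= h -> (forall i, 1 <= f i <= 1 + h) ->
  (forall i, y i = e * (x i * f i)) -> proj_dist x y <= h.
Proof.
move=> e0 h0 fh yE; rewrite /proj_dist.
set N := \big[_/_]_i _; set X := \big[_/_]_i `|x i|; set Y := \big[_/_]_i `|y i|.
have X0 : 0 <= X by apply: bigmax_ge_id.
have [->|X1] := eqVneq X 0; first by rewrite mul0r invr0 mulr0.
have XY : e * X <= Y.
  rewrite mulrC -ler_pdivlMr //; apply: bigmax_le => [|i _].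
    by rewrite divr_ge0 ?(ltW e0) ?bigmax_ge_id.
  rewrite ler_pdivlMr //; apply: le_trans (le_bigmax _ _ i).
  have /andP [f1 _] := fh i; have f0 := le_trans ler01 f1.
  rewrite yE !normrM (gtr0_norm e0) (ger0_norm f0) mulrC.
  by rewrite ler_pM2l // ler_peMr.
have Xp : 0 < X by rewrite lt_neqAle eq_sym X1.
have Y0 : 0 < Y by apply: lt_le_trans XY; rewrite mulr_gt0.
rewrite ler_pdivrMr ?mulr_gt0 //.
apply: le_trans (_ : h * (X * (e * X)) <= _); last first.
  by rewrite ler_wpM2l // ler_pM2l.
have bd0 : 0 <= h * (X * (e * X)) by rewrite !mulr_ge0 // ltW.
apply: bigmax_le => // i _; apply: bigmax_le => // j _.
have -> : x i * y j - x j * y i = e * (x i * x j) * (f j - f i).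
  by rewrite !yE; ring.
rewrite !normrM (gtr0_norm e0) mulrC; apply: ler_pM; rewrite ?mulr_ge0 ?(ltW e0) //.
  have /andP [? ?] := fh i; have /andP [? ?] := fh j.
  by rewrite ler_norml; lra.
rewrite mulrCA; apply: ler_pM; rewrite ?mulr_ge0 ?(ltW e0) //; first exact: le_bigmax.
by rewrite ler_pM2l //; exact: le_bigmax.
Qed.

(** The torus acts on each of the three projective lines by a scalar. *)
Lemma embedding_scale (y z w : 'I_6 -> R) : torus_log w ->
  (forall i, y i = expR (w i) * z i) ->
  forall k, embedding y k =
    expR (w rS0 + w rE1 + (w rT0 + w rE2) + (w rS0 + w rT0)) * embedding z k.
Proof.
move=> [w1 w2] yE k.
have w3 : w rS0 + w rT0 = w rS1 + w rT1 by lra.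
have S a : coordS y a = expR (w rS0 + w rE1) * coordS z a.
  by rewrite /coordS; case: ifP => _; [|rewrite w1]; rewrite !yE expRD; ring.
have T a : coordT y a = expR (w rT0 + w rE2) * coordT z a.
  by rewrite /coordT; case: ifP => _; [|rewrite w2]; rewrite !yE expRD; ring.
have U a : coordU y a = expR (w rS0 + w rT0) * coordU z a.
  by rewrite /coordU; case: ifP => _; [|rewrite w3]; rewrite !yE expRD; ring.
by rewrite /embedding S T U !expRD; ring.
Qed.

Lemma same_pt_det (K : fieldType) (y z : 'I_6 -> K) : same_pt y z ->
  y rS0 * y rT0 = y rT1 * y rS1 -> z rS0 * z rT0 = z rT1 * z rS1.
Proof.
move=> [l [l0 l1 l2 zE]] e; have [h1 h2] := torus_relations l0 l1 l2.
rewrite !zE.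
have h3 : l rS0 * l rT0 = l rT1 * l rS1.
  apply: (mulIf (l0 rE1)); apply: (mulIf (l0 rE2)).
  transitivity (l rS0 * l rE1 * (l rT0 * l rE2)); first by ring.
  by rewrite h1 h2; ring.
transitivity (l rS0 * l rT0 * (y rS0 * y rT0)); first by ring.
by rewrite h3 e; ring.
Qed.

End Distance.

Section UpperBound.
Variables (R : realType) (p : 'I_6 -> int).
Local Notation C := R[i].
Hypotheses (zp : zpt p) (Dp : curveD R (ofZ C p)).
Variable l : contact_line p.

Definition line_degree (A : toric_div) : int := \sum_k A k * line_deg l k.

Let g (N : int) : R := 1 + N%:~R^-1.
Let w (N : int) (k : 'I_6) : R := (line_deg l k)%:~R * ln N%:~R.

Lemma line_log_torus N : torus_log (w N).
Proof.
have [] := line_deg_balanced l.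
rewrite !sum6E /ray /= => /(congr1 (intr : int -> R)) + /(congr1 (intr : int -> R)).
rewrite !mulr0 !mulr1 !mulrN1 !addr0 !intrD !intrN => e1 e2.
by split; rewrite /w -!mulrDl; congr (_ * _); lra.
Qed.

Lemma line_log_degree A N : log_weight A (w N) = (line_degree A)%:~R * ln N%:~R.
Proof.
rewrite /log_weight /line_degree rmorph_sum /= mulr_suml; apply: eq_bigr => k _.
by rewrite /w intrM mulrA.
Qed.

(** The integral point with parameters N + 1 and N is the image under a torus
   element of the point of the line with parameters 1 + 1/N and 1. *)
Lemma line_ptE (N : int) k : 0 < N ->
  (line_pt l (N + 1) N k)%:~R
  = expR (w N k) * ((p k)%:~R * line_factor l (g N) 1 k).
Proof.
move=> N0; have N0R : 0 < N%:~R :> R by rewrite ltr0z.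
rewrite /line_pt /line_factor /w /g intrM.
case: eqP => [->|/eqP ki].
  by rewrite line_deg_fst mul1r lnK ?posrE // intrD; field; rewrite gt_eqF.
case: eqP => [->|/eqP kj].
  by rewrite line_deg_snd mul1r lnK ?posrE //; ring.
case: (line_deg_fixed ki kj) => [[-> _]|[-> _]]; rewrite ?mul0r ?mulr0 //.
by rewrite expR0 mul1r.
Qed.

(** Each coordinate of the three projective lines contains the moving coordinate
   [fst_ix] at most once, so the embedded coordinates change by a factor of at
   most (1 + 1/N)^3, which is at most 1 + 7/N. *)
Lemma line_dist N : 0 < N ->
  dist (ofZ R p) (ofZ R (line_pt l (N + 1) N)) <= 7 / N%:~R.
Proof.
move=> N0; have N1 : 1 <= N%:~R :> R by rewrite ler1z; lia.
have N0R := lt_le_trans ltr01 N1.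
pose z k : R := (p k)%:~R * line_factor l (g N) 1 k.
pose F k : R := line_factor l (g N) 1 k.
have := embedding_scale (line_log_torus N) (fun k => line_ptE k N0).
rewrite -/z => E.
pose cS (k : 'I_2) := if k == 0 then F rS0 * F rE1 else F rS1 * F rE2.
pose cT (k : 'I_2) := if k == 0 then F rT0 * F rE2 else F rT1 * F rE1.
pose cU (k : 'I_2) := if k == 0 then F rS0 * F rT0 else F rS1 * F rT1.
have t0 : 0 < N%:~R^-1 :> R by rewrite invr_gt0.
have t1 : N%:~R^-1 <= 1 :> R by rewrite invf_le1.
have bound a b : ~~ ((a == fst_ix l) && (b == fst_ix l)) -> 1 <= F a * F b <= g N.
  rewrite /F /line_factor /g.
  by case: eqP => _; case: eqP => _ //= _; rewrite ?if_same ?mulr1 ?mul1r; lra.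
have bS k : 1 <= cS k <= g N.
  by rewrite /cS; case: ifP => _; apply: bound; case: (fst_ixE l) => ->.
have bT k : 1 <= cT k <= g N.
  by rewrite /cT; case: ifP => _; apply: bound; case: (fst_ixE l) => ->.
have bU k : 1 <= cU k <= g N.
  by rewrite /cU; case: ifP => _; apply: bound; case: (fst_ixE l) => ->.
apply: (proj_dist_le (f := fun k => cS k.1.1 * cT k.1.2 * cU k.2)) (expR_gt0 _) _ _ _.
- by rewrite divr_ge0 // ltW.
- move=> k; have /andP [s1 s2] := bS k.1.1; have /andP [t1' t2] := bT k.1.2.
  have /andP [u1 u2] := bU k.2.
  have g0 : 0 <= g N by rewrite addr_ge0 // ltW.
  have p1 : 1 <= cS k.1.1 * cT k.1.2 by rewrite -[1]mulr1 ler_pM.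
  have q1 : 1 <= cS k.1.1 * cT k.1.2 * cU k.2 by rewrite -[1]mulr1 ler_pM.
  rewrite q1 /=; apply: le_trans (_ : g N * g N * g N <= _).
    by rewrite ler_pM ?ler_pM ?mulr_ge0 //; lra.
  rewrite /g; set t := N%:~R^-1 in t0 t1 *.
  have tt : t * t <= t by rewrite -[leRHS]mulr1 ler_pM2l.
  have ttt : t * t * t <= t by rewrite -mulrA -[leRHS]mulr1 ler_pM2l // (le_trans tt).
  have -> : (1 + t) * (1 + t) * (1 + t) = 1 + 3 * t + 3 * (t * t) + t * t * t by ring.
  by rewrite /=; lra.
- move=> k; rewrite [LHS]E; congr (_ * _).
  rewrite /embedding /coordS /coordT /coordU /cS /cT /cU /z -!/(F _) /ofZ.
  by do 3!case: ifP => _; ring.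
Qed.

(** With distance of order 1/N and height of order N^e, every positive exponent
   greater than e keeps d^a H bounded; e itself is excluded here since it
   could be zero. *)
Lemma alpha_line_le (A : toric_div) (H : ('I_6 -> int) -> R)
    (W : set ('I_6 -> int)) (N : nat -> int) :
  weil_height R A H -> 0 <= line_degree A -> (forall n, n%:Z < N n) ->
  (forall n, zpt (line_pt l (N n + 1) (N n))) ->
  (forall n, W (line_pt l (N n + 1) (N n))) ->
  (alpha (ofZ R p) W H <= ((line_degree A)%:~R)%:E)%E.
Proof.
move=> HA dA nN zy Wy; set e : R := (line_degree A)%:~R.
pose y n := line_pt l (N n + 1) (N n).
have N0 n : 0 < N n by have := nN n; lia.
have cp := zpt_coxpt C zp.
pose K : R := 2 * \sum_k `|(p k)%:~R|.
have [c [c0 Hc]] := weil_height_compare K HA cp (ltr01 : 0 < 1 :> R).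
have Hy n : H (y n) <= c * expR (e * ln (N n)%:~R).
  have N1 : 1 <= (N n)%:~R :> R by rewrite ler1z; have := N0 n; lia.
  have t0 : 0 < (N n)%:~R^-1 :> R by rewrite invr_gt0 (lt_le_trans ltr01).
  have t1 : (N n)%:~R^-1 <= 1 :> R by rewrite invf_le1 // (lt_le_trans ltr01).
  have F1 k : 1 <= line_factor l (g (N n)) 1 k <= 2.
    by rewrite /line_factor /g; do 2?case: ifP => _; lra.
  have := Hc (y n) (w (N n)) (fun k => `|(p k)%:~R| * line_factor l (g (N n)) 1 k).
  case/(_ (zy n) (line_log_torus _) _ _ _)/andP => [k|k|k pk|_].
  - have /andP [f1 f2] := F1 k.
    rewrite line_ptE // !normrM (gtr0_norm (expR_gt0 _)); congr (_ * (_ * _)).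
    by rewrite ger0_norm // (le_trans ler01).
  - have /andP [f1 f2] := F1 k; have f0 := le_trans ler01 f1.
    rewrite mulr_ge0 //= /K mulrC ler_pM //.
    by rewrite (bigD1 k) //= lerDl sumr_ge0.
  - have /andP [f1 f2] := F1 k.
    apply: le_trans (ler_peMr (normr_ge0 _) f1).
    by rewrite -intr_norm ler1z; move: pk; rewrite /ofZ intr_eq0; lia.
  - by rewrite line_log_degree.
have pun n : punctured (ofZ R p) W (y n).
  split; first exact: Wy.
  move=> /same_pt_det /=; rewrite /ofZ -!intrM (det_of_curveD Dp) => /(_ erefl) /eqP.
  rewrite eqr_int -subr_eq0 (line_pt_det Dp) addrAC subrr add0r mulr1.
  by rewrite mulf_eq0 -!(intr_eq0 R) !(negbTE (moving_neq0 zp Dp _ _)) ?inE ?eqxx ?orbT.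
have dN n : dist (ofZ R p) (ofZ R (y n)) <= 7 * harmonic n.
  apply: le_trans (line_dist (N0 n)) _.
  rewrite ler_pM2l // /harmonic lef_pV2 ?posrE ?ltr0z // ?ltr0n //.
  by rewrite -[_.+1%:R]/((n.+1)%:Z%:~R) ler_int; have := nN n; lia.
have d0 n : 0 <= dist (ofZ R p) (ofZ R (y n)) by exact: proj_dist_ge0.
have dcvg : dist (ofZ R p) (ofZ R (y n)) @[n --> \oo] --> (0 : R).
  apply: (@squeeze_cvgr _ _ _ _ (fun=> 0) (fun n => 7 * harmonic n)).
  - by apply: nearW => n; rewrite d0 dN.
  - exact: cvg_cst.
  - by rewrite -[X in _ --> X](mulr0 (7 : R)); apply: cvgMr; exact: cvg_harmonic.
rewrite /alpha asboolT; last first.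
  move=> r r0; have /cvgrPdist_lt /(_ r r0) [n _ /(_ n (leqnn n))] := dcvg.
  by rewrite sub0r normrN ger0_norm // => h; exists (y n).
apply/lee_addgt0Pr => r r0; apply: ge_ereal_inf; exists (e + r)%:E => //.
exists (e + r) => //; split; first by rewrite ltr_wpDl // ler0z.
exists y; split=> //; exists (7 `^ (e + r) * c) => n.
have er : 0 <= e + r by rewrite addr_ge0 ?(ltW r0) // ler0z.
have Np : 0 < (N n)%:~R :> R by rewrite ltr0z.
apply: le_trans (_ : (7 / (N n)%:~R) `^ (e + r) * (c * expR (e * ln (N n)%:~R)) <= _).
  apply: le_trans (_ : dist (ofZ R p) (ofZ R (y n)) `^ (e + r)
    * (c * expR (e * ln (N n)%:~R)) <= _).
    by rewrite ler_wpM2l ?powR_ge0.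
  rewrite ler_wpM2r ?mulr_ge0 ?(ltW c0) ?expR_ge0 //.
  apply: ge0_ler_powR; rewrite ?nnegrE ?d0 ?line_dist //.
  by rewrite divr_ge0 ?(ltW Np).
rewrite powRM ?invr_ge0 ?(ltW Np) // -!mulrA ler_wpM2l ?powR_ge0 //.
rewrite mulrCA -[leRHS]mulr1 ler_pM2l // /powR invr_eq0 gt_eqF // lnV ?posrE //.
rewrite -expRD -[leRHS]expR0 ler_expR mulrN -mulNr -mulrDl opprD addrAC addNr add0r.
rewrite mulNr oppr_le0 mulr_ge0 ?(ltW r0) // ln_ge0 // ler1z; have := N0 n; lia.
Qed.

End UpperBound.

(** * The four lines *)

Lemma coprimez_unit (a b : int) : `|a| = 1 -> coprimez a b.
Proof.
move=> a1; have : absz a = 1%N by lia.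
by rewrite coprimezE => ->; rewrite coprime1n.
Qed.

(** By the Chinese remainder theorem: N is 0 modulo a and 1 modulo b. *)
Lemma coprime_neighbours_unbounded (a b : int) :
  coprimez a b -> a != 0 -> b != 0 ->
  exists N : nat -> int, forall n,
    [/\ n%:Z < N n, coprimez (N n + 1) a & coprimez (N n) b].
Proof.
move=> /coprimezP [[u v] /= uv] a0 b0.
exists (fun n => u * a + (n%:Z + `|u * a| + 1) * (a * b) ^+ 2) => n.
set k := n%:Z + `|u * a| + 1; split.
- have ab : 1 <= (a * b) ^+ 2.
    by have : 0 < (a * b) ^+ 2 by rewrite exprn_even_gt0 // mulf_neq0.
  have : k <= k * (a * b) ^+ 2 by rewrite ler_peMr //; lia.
  lia.
- apply/coprimezP; exists (1, - (u + k * a * b ^+ 2)) => /=; ring.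
- apply/coprimezP; exists (1, v - k * a ^+ 2 * b) => /=; rewrite -[RHS]uv; ring.
Qed.

Section FourLines.
Variables (R : realType) (p : 'I_6 -> int).
Local Notation C := R[i].
Hypotheses (zp : zpt p) (Dp : curveD R (ofZ C p)).

Lemma moving_int_neq0 k : k \in [:: rS0; rT0; rT1; rS1] -> p k != 0.
Proof. by move=> /(moving_neq0 zp Dp C); rewrite intr_eq0. Qed.

(** The moving coordinates are units at p, so only p rE1 and p rE2 can share a
   factor with the parameters. *)
Lemma zpt_line (l : contact_line p) (a b : int) : coprimez a b ->
  (forall k, k \in [:: rE1; rE2] -> ~~ neighbours (fst_ix l) k -> coprimez a (p k)) ->
  (forall k, k \in [:: rE1; rE2] -> ~~ neighbours (snd_ix l) k -> coprimez b (p k)) ->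
  zpt (line_pt l a b).
Proof.
move=> ab ha hb.
have pu k : k \in [:: rS0; rT0; rT1; rS1] -> `|p k| = 1 by exact: moving_unit zp Dp k.
have nsym x y : neighbours x y = neighbours y x by rewrite /neighbours orbC.
have tl k : (k \in [:: rS0; rT0; rT1; rS1]) || (k \in [:: rE1; rE2]).
  by case: (ord6E k) => [] [] ->.
have ui := fst_moving l; have uj := snd_moving l.
set i := fst_ix l in ha ui; set j := snd_ix l in hb uj.
have one (k m : 'I_6) c : k \in [:: rS0; rT0; rT1; rS1] ->
    (forall q, q \in [:: rE1; rE2] -> ~~ neighbours k q -> coprimez c (p q)) ->
    ~~ neighbours k m -> coprimez (p k * c) (p m).
  move=> uk hc nkm; rewrite coprimezMl coprimez_unit ?pu //=.
  case/orP: (tl m) => mm; last exact: hc.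
  by rewrite coprimez_sym coprimez_unit // pu.
have two c d (k m : 'I_6) : k \in [:: rS0; rT0; rT1; rS1] ->
    m \in [:: rS0; rT0; rT1; rS1] -> coprimez c d -> coprimez (p k * c) (p m * d).
  by move=> uk um cd; rewrite coprimezMl !coprimezMr !(coprimez_unit _ (pu _ _)) //=
    coprimez_sym coprimez_unit ?pu.
move=> x y xy nxy; rewrite /line_pt /line_factor -/i -/j.
case: (eqVneq x i) => [xi|xi].
  case: (eqVneq y i) => [yi|yi]; first by move: xy; rewrite xi yi eqxx.
  case: (eqVneq y j) => [yj|yj]; first by rewrite xi yj; apply: two.
  by rewrite mulr1 xi; apply: one => //; rewrite -xi.
case: (eqVneq x j) => [xj|xj].
  case: (eqVneq y i) => [yi|yi]; first by rewrite xj yi; apply: two; rewrite // coprimez_sym.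
  case: (eqVneq y j) => [yj|yj]; first by move: xy; rewrite xj yj eqxx.
  by rewrite mulr1 xj; apply: one => //; rewrite -xj.
rewrite mulr1.
case: (eqVneq y i) => [yi|yi].
  by rewrite coprimez_sym yi; apply: one => //; rewrite -yi nsym.
case: (eqVneq y j) => [yj|yj].
  by rewrite coprimez_sym yj; apply: one => //; rewrite -yj nsym.
by rewrite mulr1; apply: zp.
Qed.

Definition approximable (l : contact_line p) : Prop :=
  exists N : nat -> int, (forall n, n%:Z < N n) /\
    forall n, zpt (line_pt l (N n + 1) (N n)).

(** At x this is L_1.  The parameter N + 1 of T0 has to be coprime to p rE1 and
   the parameter N of T1 to p rE2, which are the exceptional coordinates not
   adjacent to them. *)
Lemma line_constant_s : p rE1 != 0 -> p rE2 != 0 ->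
  exists l : contact_line p,
    [/\ fst_ix l = rT0, snd_ix l = rT1, approximable l
      & forall A, line_degree l A = A rT0 + A rT1].
Proof.
move=> p1 p4; pose d (k : 'I_6) : int := (k == rT0)%:R + (k == rT1)%:R.
have pm := moving_int_neq0.
unshelve eexists (@ContactLine p rT0 rT1 rE2 rE1 d _ _ _ _ _ _ _ _ _); [by right|by left|..].
- by exists (0, -1) => k; case: (ord6E k) => [] [] ->; rewrite !ffunE.
- by [].
- by [].
- by [].
- by [].
- by move=> k; case: (ord6E k) => [] [] -> //= _ _; left; split=> //; apply: pm.
- by rewrite !sum6E.
split=> //=; last by move=> A; rewrite /line_degree sum6E /= /d /=; ring.
have [N HN] := coprime_neighbours_unbounded (zp (i := rE1) (j := rE2) isT isT) p1 p4.
exists N; split=> n; have [n1 n2 n3] := HN n; first by [].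
apply: zpt_line.
- by apply/coprimezP; exists (1, -1) => /=; ring.
- by move=> k; rewrite !inE => /orP [] /eqP ->.
- by move=> k; rewrite !inE => /orP [] /eqP ->.
Qed.

(** At x this is L_2; the conditions are those of [line_constant_s] with the two
   exceptional coordinates exchanged. *)
Lemma line_constant_t : p rE1 != 0 -> p rE2 != 0 ->
  exists l : contact_line p,
    [/\ fst_ix l = rS0, snd_ix l = rS1, approximable l
      & forall A, line_degree l A = A rS0 + A rS1].
Proof.
move=> p1 p4; pose d (k : 'I_6) : int := (k == rS0)%:R + (k == rS1)%:R.
have pm := moving_int_neq0.
unshelve eexists (@ContactLine p rS0 rS1 rE1 rE2 d _ _ _ _ _ _ _ _ _); [by left|by right|..].
- by exists (-1, 0) => k; case: (ord6E k) => [] [] ->; rewrite !ffunE.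
- by [].
- by [].
- by [].
- by [].
- by move=> k; case: (ord6E k) => [] [] -> //= _ _; left; split=> //; apply: pm.
- by rewrite !sum6E.
split=> //=; last by move=> A; rewrite /line_degree sum6E /= /d /=; ring.
have [N HN] := coprime_neighbours_unbounded (zp (i := rE2) (j := rE1) isT isT) p4 p1.
exists N; split=> n; have [n1 n2 n3] := HN n; first by [].
apply: zpt_line.
- by apply/coprimezP; exists (1, -1) => /=; ring.
- by move=> k; rewrite !inE => /orP [] /eqP ->.
- by move=> k; rewrite !inE => /orP [] /eqP ->.
Qed.

Lemma exceptional_unit (a b : 'I_6) :
  a != b -> ~~ neighbours a b -> p a = 0 -> `|p b| = 1.
Proof. by move=> ab nab pa; have := zp ab nab; rewrite pa /coprimez gcd0z => /eqP. Qed.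

(** The exceptional curve over z1, of self-intersection -1; u0/u1 is a parameter
   on it. *)
Lemma line_E1 : p rE1 = 0 ->
  exists l : contact_line p,
    approximable l /\ forall A, line_degree l A = A rS0 + A rT1 - A rE1.
Proof.
move=> p1; pose d (k : 'I_6) : int := (k == rS0)%:R + (k == rT1)%:R - (k == rE1)%:R.
have pm := moving_int_neq0.
have p4 : `|p rE2| = 1 by apply: (@exceptional_unit rE1).
have p4n : p rE2 != 0 by lia.
unshelve eexists (@ContactLine p rS0 rT1 rT0 rS1 d _ _ _ _ _ _ _ _ _); [by left|by left|..].
- by exists (-1, -1) => k; case: (ord6E k) => [] [] ->; rewrite !ffunE.
- by [].
- by split; apply: pm.
- by [].
- by [].
- by move=> k; case: (ord6E k) => [] [] -> //= _ _; [right|left..]; split=> //; apply: pm.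
- by rewrite !sum6E.
split; last by move=> A; rewrite /line_degree sum6E /= /d /=; ring.
exists (fun n => n%:Z + 1); split=> n; first by lia.
apply: zpt_line.
- by apply/coprimezP; exists (1, -1) => /=; ring.
- by move=> k; rewrite !inE => /orP [] /eqP -> // _; rewrite coprimez_sym coprimez_unit.
- by move=> k; rewrite !inE => /orP [] /eqP -> // _; rewrite coprimez_sym coprimez_unit.
Qed.

(** The exceptional curve over z2, likewise. *)
Lemma line_E2 : p rE2 = 0 ->
  exists l : contact_line p,
    approximable l /\ forall A, line_degree l A = A rS1 + A rT0 - A rE2.
Proof.
move=> p4; pose d (k : 'I_6) : int := (k == rT0)%:R + (k == rS1)%:R - (k == rE2)%:R.
have pm := moving_int_neq0.
have p1 : `|p rE1| = 1 by apply: (@exceptional_unit rE2).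
have p1n : p rE1 != 0 by lia.
unshelve eexists (@ContactLine p rT0 rS1 rS0 rT1 d _ _ _ _ _ _ _ _ _); [by right|by right|..].
- by exists (-1, -1) => k; case: (ord6E k) => [] [] ->; rewrite !ffunE.
- by [].
- by split; apply: pm.
- by [].
- by [].
- move=> k; case: (ord6E k) => [] [] -> //= _ _; first [by right|by left; split=> //; apply: pm].
- by rewrite !sum6E.
split; last by move=> A; rewrite /line_degree sum6E /= /d /=; ring.
exists (fun n => n%:Z + 1); split=> n; first by lia.
apply: zpt_line.
- by apply/coprimezP; exists (1, -1) => /=; ring.
- by move=> k; rewrite !inE => /orP [] /eqP -> // _; rewrite coprimez_sym coprimez_unit.
- by move=> k; rewrite !inE => /orP [] /eqP -> // _; rewrite coprimez_sym coprimez_unit.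
Qed.

End FourLines.

(** * Charts around a boundary point *)

(** The intersection number of A with the boundary curve k, which meets its two
   neighbours once and has self-intersection -1. *)
Definition boundary_degree (A : toric_div) (k : 'I_6) : int :=
  A (ordS k) + A (ord_pred k) - A k.

Lemma boundary_degreeE (A : toric_div) :
  [/\ boundary_degree A rS0 = A rE1 + A rT0 - A rS0,
      boundary_degree A rE1 = A rT1 + A rS0 - A rE1
    & boundary_degree A rT1 = A rS1 + A rE1 - A rT1] /\
  [/\ boundary_degree A rS1 = A rE2 + A rT1 - A rS1,
      boundary_degree A rE2 = A rT0 + A rS1 - A rE2
    & boundary_degree A rT0 = A rS0 + A rE2 - A rT0].
Proof.
have E k a b : ordS k = a -> ord_pred k = b -> boundary_degree A k = A a + A b - A k.
  by move=> <- <-.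
by split; split; apply: E; apply: val_inj.
Qed.

(** The rotation of the fan by a half turn exchanges E1 and E2 and, up to sign,
   preserves the equation of D.  Using it one may assume that the E2-coordinate
   of p is the larger one, in particular nonzero; [chart r] is the indexing of the
   coordinates after r half turns. *)
Definition opposite (k : 'I_6) : 'I_6 :=
  nth rS0 [:: rS1; rE2; rT0; rS0; rE1; rT1] k.

Definition chart (r : bool) (k : 'I_6) : 'I_6 := if r then opposite k else k.

Lemma chartK r : involutive (chart r).
Proof.
move=> k; rewrite /chart; case: r => //.
by case: (ord6E k) => [] [] ->; apply: val_inj.
Qed.

Section Charts.
Variable R : realType.
Local Notation C := R[i].

(** If the coordinate o is maximal at x, it is at least half of the maximum at a
   point y near x; so the affine coordinates with respect to o are controlled by
   the distance. *)
Lemma proj_dist_ratio (I : finType) (x y : I -> R) (o : I) :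
  (forall i, `|x i| <= `|x o|) -> x o != 0 -> (exists i, y i != 0) ->
  proj_dist x y <= 2^-1 ->
  y o != 0 /\ forall i, `|y i / y o - x i / x o| <= 2 * proj_dist x y.
Proof.
move=> xo xo0 [j0 yj0]; set d := proj_dist x y => d2.
have bm0 (F : I -> R) : 0 <= \big[Num.max/0]_i F i by apply: bigmax_ge_id.
have X : \big[Num.max/0]_i `|x i| = `|x o|.
  by apply/le_anti; rewrite bigmax_le ?le_bigmax.
set Y := \big[Num.max/0]_i `|y i|.
have Yp : 0 < Y by apply: lt_le_trans (le_bigmax _ _ j0); rewrite normr_gt0.
have Xp : 0 < `|x o| by rewrite normr_gt0.
have cross i j : `|x i * y j - x j * y i| <= d * (`|x o| * Y).
  rewrite /d /proj_dist X -/Y divfK; last by rewrite mulf_neq0 // gt_eqF.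
  apply: le_trans (le_bigmax _ _ i).
  exact: (le_bigmax _ (fun j => `|x i * y j - x j * y i|)).
have d0 : 0 <= d by exact: proj_dist_ge0.
have yo : Y <= `|y o| + d * Y.
  apply: bigmax_le => [|j _]; first by rewrite addr_ge0 // mulr_ge0 // ltW.
  have h1 : `|x o * y j| <= `|x j * y o| + d * (`|x o| * Y).
    by rewrite -lerBlDl; apply: le_trans (lerB_dist _ _) (cross o j).
  have h2 : `|x j * y o| <= `|x o| * `|y o| by rewrite normrM ler_wpM2r.
  have h3 : `|x o| * `|y j| <= `|x o| * (`|y o| + d * Y).
    by rewrite -normrM mulrDr (le_trans h1) // [`|x o| * (d * Y)]mulrCA lerD2r.
  by move: h3; rewrite ler_pM2l.
have dY : d * Y <= 2^-1 * Y by rewrite ler_pM2r.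
have yop : 0 < `|y o| by lra.
have yo0 : y o != 0 by rewrite -normr_gt0.
split=> // i.
have -> : y i / y o - x i / x o = (x o * y i - x i * y o) / (x o * y o).
  by field; rewrite xo0 yo0.
rewrite normrM normfV ler_pdivrMr ?normr_gt0 ?mulf_neq0 // normrM.
apply: le_trans (cross o i) _.
have -> : 2 * d * (`|x o| * `|y o|) = d * (`|x o| * (2 * `|y o|)) by ring.
by rewrite ler_wpM2l // ler_pM2l //; lra.
Qed.

(** The affine coordinates s0/s1, t1/t0 and u1/u0, up to the rotation. *)
Definition ratioS r (z : 'I_6 -> R) : R :=
  z (chart r rS0) * z (chart r rE1) / (z (chart r rS1) * z (chart r rE2)).
Definition ratioT r (z : 'I_6 -> R) : R :=
  z (chart r rT1) * z (chart r rE1) / (z (chart r rT0) * z (chart r rE2)).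
Definition ratioU r (z : 'I_6 -> R) : R :=
  z (chart r rT1) * z (chart r rS1) / (z (chart r rS0) * z (chart r rT0)).

Lemma embedding_neq0 (z : 'I_6 -> R) : coxpt z -> exists k, embedding z k != 0.
Proof.
move=> cz.
have c a b : a != b -> ~~ neighbours a b -> z a = 0 -> z b = 0 -> False.
  by move=> ab nab za zb; have := cz a b ab nab; rewrite za zb eqxx.
have [a Sa] : exists a, coordS z a != 0.
  case: (eqVneq (coordS z 0) 0) => [e0|]; last by exists 0.
  case: (eqVneq (coordS z 1) 0) => [e1|]; last by exists 1.
  move/eqP: e0; move/eqP: e1; rewrite /coordS /= !mulf_eq0.
  by move=> /orP [] /eqP h1 /orP [] /eqP h2; exfalso; apply: c h1 h2.
have [b Tb] : exists a, coordT z a != 0.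
  case: (eqVneq (coordT z 0) 0) => [e0|]; last by exists 0.
  case: (eqVneq (coordT z 1) 0) => [e1|]; last by exists 1.
  move/eqP: e0; move/eqP: e1; rewrite /coordT /= !mulf_eq0.
  by move=> /orP [] /eqP h1 /orP [] /eqP h2; exfalso; apply: c h1 h2.
have [d Ud] : exists a, coordU z a != 0.
  case: (eqVneq (coordU z 0) 0) => [e0|]; last by exists 0.
  case: (eqVneq (coordU z 1) 0) => [e1|]; last by exists 1.
  move/eqP: e0; move/eqP: e1; rewrite /coordU /= !mulf_eq0.
  by move=> /orP [] /eqP h1 /orP [] /eqP h2; exfalso; apply: c h1 h2.
by exists (a, b, d); rewrite /embedding !mulf_neq0.
Qed.

(** The embedded coordinate s1 * t0 * u0 is maximal at q, and each ratio is the
   quotient of another embedded coordinate by it. *)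
Lemma chart_estimates (r : bool) (q z : 'I_6 -> R) :
  (forall k, k \in [:: rS0; rT0; rT1; rS1] -> `|q k| = 1) ->
  `|q (chart r rE1)| <= `|q (chart r rE2)| -> q (chart r rE2) != 0 ->
  coxpt z -> dist q z <= 2^-1 ->
  [/\ z (chart r rS0) != 0, z (chart r rS1) != 0, z (chart r rE2) != 0
    & z (chart r rT0) != 0] /\
  [/\ `|ratioS r z - ratioS r q| <= 2 * dist q z,
      `|ratioT r z - ratioT r q| <= 2 * dist q z
    & `|ratioU r z - ratioU r q| <= 2 * dist q z].
Proof.
move=> uq q14 q4 cz dz.
have [u0 u5 u2 u3] : [/\ `|q rS0| = 1, `|q rT0| = 1, `|q rT1| = 1 & `|q rS1| = 1].
  by split; apply: uq; rewrite !inE eqxx ?orbT.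
pose a : 'I_2 := if r then 1 else 0; pose b : 'I_2 := if r then 0 else 1.
have SE (x : 'I_6 -> R) : coordS x a = x (chart r rS0) * x (chart r rE1) /\
    coordS x b = x (chart r rS1) * x (chart r rE2).
  by rewrite /a /b /coordS; case: (r).
have TE (x : 'I_6 -> R) : coordT x b = x (chart r rT1) * x (chart r rE1) /\
    coordT x a = x (chart r rT0) * x (chart r rE2).
  by rewrite /a /b /coordT; case: (r).
have UE (x : 'I_6 -> R) : coordU x b = x (chart r rT1) * x (chart r rS1) /\
    coordU x a = x (chart r rS0) * x (chart r rT0).
  by rewrite /a /b /coordU; case: (r); split=> //=; rewrite mulrC.
pose Q := `|q (chart r rE2)|.
have uc k : k \in [:: rS0; rT0; rT1; rS1] -> `|q (chart r k)| = 1.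
  by rewrite !inE => /or4P [] /eqP ->; rewrite /chart; case: (r).
have ab k : k = a \/ k = b.
  by rewrite /a /b; case: (r); case: (ord2E k) => ->; [right|left|left|right].
have S1 k : `|coordS q k| <= Q.
  have [h1 h2] := SE q.
  by case: (ab k) => ->; rewrite ?h1 ?h2 normrM uc // mul1r.
have T1 k : `|coordT q k| <= Q.
  have [h1 h2] := TE q.
  by case: (ab k) => ->; rewrite ?h1 ?h2 normrM uc // mul1r.
have U1 k : `|coordU q k| <= 1.
  have [h1 h2] := UE q.
  by case: (ab k) => ->; rewrite ?h1 ?h2 normrM !uc // mul1r.
have Eo : `|embedding q (b, a, a)| = Q * Q * 1.
  have [_ h1] := SE q; have [_ h2] := TE q; have [_ h3] := UE q.
  by rewrite /embedding /= h1 h2 h3 !normrM (uc rS1) // (uc rT0) // (uc rS0) // !mul1r.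
have := @proj_dist_ratio _ (embedding q) (embedding z) (b, a, a).
case=> [k||||].
- by rewrite Eo /embedding !normrM !ler_pM // mulr_ge0.
- by rewrite -normr_eq0 Eo mulr1 mulf_neq0 // normr_eq0.
- exact: embedding_neq0.
- exact: dz.
rewrite {1}/embedding /= !mulf_eq0 !negb_or => /andP [/andP [Sz Tz] Uz] est.
have /andP [/andP [Sq Tq] Uq] : (coordS q b != 0) && (coordT q a != 0) && (coordU q a != 0).
  have : embedding q (b, a, a) != 0.
    by rewrite -normr_eq0 Eo mulr1 mulf_neq0 // normr_eq0.
  by rewrite /embedding /= !mulf_eq0 !negb_or.
have [hS1 hS2] := SE z; have [hT1 hT2] := TE z; have [hU1 hU2] := UE z.
have [kS1 kS2] := SE q; have [kT1 kT2] := TE q; have [kU1 kU2] := UE q.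
split.
  move: Sz Uz; rewrite hS2 hU2 !mulf_eq0 !negb_or.
  by move=> /andP [-> ->] /andP [-> ->].
split.
- have := est (a, a, a); rewrite /embedding /= /ratioS -hS1 -hS2 -kS1 -kS2 -/(dist q z).
  have fE (s s' t u : R) : t != 0 -> u != 0 -> s' != 0 -> s * t * u / (s' * t * u) = s / s'.
    by move=> *; field; do ?[apply/andP; split].
  by rewrite !fE.
- have := est (b, b, a); rewrite /embedding /= /ratioT -hT1 -hT2 -kT1 -kT2 -/(dist q z).
  have fE (s t t' u : R) : s != 0 -> u != 0 -> t' != 0 -> s * t * u / (s * t' * u) = t / t'.
    by move=> *; field; do ?[apply/andP; split].
  by rewrite !fE.
- have := est (b, a, b); rewrite /embedding /= /ratioU -hU1 -hU2 -kU1 -kU2 -/(dist q z).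
  have fE (s t u u' : R) : s != 0 -> t != 0 -> u' != 0 -> s * t * u / (s * t * u') = u / u'.
    by move=> *; field; do ?[apply/andP; split].
  by rewrite !fE.
Qed.

(** Two expressions for the class of A, the first through the three conic classes
   and the curve E2, the second through the conic classes and E1.  For nef A only
   the coefficient of E1 or E2 may be negative, and it is so in at most one of
   them. *)
Lemma log_weight_chart (r : bool) (A : toric_div) (w : 'I_6 -> R) :
  torus_log w ->
  let n k : R := (boundary_degree A (chart r k))%:~R in
  let u k := w (chart r k) in
  log_weight A w = n rT1 * (u rS1 + u rE2) + n rS0 * (u rE2 + u rT0)
      + n rE1 * (u rS0 + u rT0) + (n rE1 - n rE2) * u rE2
  /\ log_weight A w = n rT0 * (u rS1 + u rE2) + n rS1 * (u rE2 + u rT0)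
      + n rE2 * (u rS0 + u rT0) + (n rE2 - n rE1) * u rE1.
Proof.
move=> [w1 w2] n u; have [[h0 h1 h2] [h3 h4 h5]] := boundary_degreeE A.
rewrite /log_weight sum6E /n /u /chart; case: r {n u}; rewrite /opposite /=.
  have -> : w rS0 = w rS1 + w rE2 - w rE1 by rewrite -w1 addrK.
  have -> : w rT0 = w rT1 + w rE1 - w rE2 by rewrite -w2 addrK.
  by rewrite h0 h1 h2 h3 h4 h5 !intrB !intrD; split; ring.
have -> : w rS1 = w rS0 + w rE1 - w rE2 by rewrite w1 addrK.
have -> : w rT1 = w rT0 + w rE2 - w rE1 by rewrite w2 addrK.
by rewrite h0 h1 h2 h3 h4 h5 !intrB !intrD; split; ring.
Qed.

Lemma torus_log_chart r (w : 'I_6 -> R) : torus_log w -> torus_log (w \o chart r).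
Proof.
by case: r => // -[h1 h2]; split; rewrite /chart /opposite /=; lra.
Qed.

Lemma ln_lower (a b : R) : 0 < a -> 0 < b -> b^-1 <= a -> - ln b <= ln a.
Proof. by move=> a0 b0 h; rewrite -lnV ?posrE // ler_ln ?posrE ?invr_gt0. Qed.

(** When the coefficient of E2 in the first expression is nonnegative, that one
   gives the bounds.  Otherwise the second one does, where u rE1 either is
   bounded below or is combined with u rS0 + u rT0. *)
Lemma log_weight_lower (r : bool) (A : toric_div) (w : 'I_6 -> R) (m b : R) :
  torus_log w -> (forall k, 0 <= boundary_degree A k) -> 0 <= b ->
  let u k := w (chart r k) in
  0 <= u rS1 + u rE2 -> 0 <= u rE2 + u rT0 -> 0 <= u rE2 ->
  m <= u rS0 + u rT0 ->
  [/\ 0 <= u rS1 + u rE2 + u rT0 -> (boundary_degree A (chart r rE1))%:~R * m <= log_weight A w,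
      - b <= u rE1 -> m <= u rS1 + u rE2 ->
      (A rS0 + A rS1)%:~R * m - (boundary_degree A (chart r rE2))%:~R * b <= log_weight A w
    & - b <= u rE1 -> m <= u rE2 + u rT0 ->
      (A rT1 + A rT0)%:~R * m - (boundary_degree A (chart r rE2))%:~R * b <= log_weight A w].
Proof.
move=> tw nef b0 u S0 T0 E0 Um.
have [f1 f2] := log_weight_chart r A tw; rewrite -!/(u _) in f1 f2.
have nn k : 0 <= (boundary_degree A (chart r k))%:~R :> R by rewrite ler0z.
have [[h0 h1 h2] [h3 h4 h5]] := boundary_degreeE A.
have s1 : (A rS0 + A rS1)%:~R = (boundary_degree A (chart r rT1))%:~R
    + (boundary_degree A (chart r rE1))%:~R :> R.
  rewrite -intrD; congr (_%:~R); rewrite /chart; case: (r); rewrite /opposite /=; lia.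
have s2 : (A rS0 + A rS1)%:~R = (boundary_degree A (chart r rT0))%:~R
    + (boundary_degree A (chart r rE2))%:~R :> R.
  rewrite -intrD; congr (_%:~R); rewrite /chart; case: (r); rewrite /opposite /=; lia.
have t1 : (A rT1 + A rT0)%:~R = (boundary_degree A (chart r rS0))%:~R
    + (boundary_degree A (chart r rE1))%:~R :> R.
  rewrite -intrD; congr (_%:~R); rewrite /chart; case: (r); rewrite /opposite /=; lia.
have t2 : (A rT1 + A rT0)%:~R = (boundary_degree A (chart r rS1))%:~R
    + (boundary_degree A (chart r rE2))%:~R :> R.
  rewrite -intrD; congr (_%:~R); rewrite /chart; case: (r); rewrite /opposite /=; lia.
have tu : u rS0 + u rE1 = u rS1 + u rE2 := (torus_log_chart r tw).1.
move: (nn rS0) (nn rE1) (nn rT1) (nn rS1) (nn rE2) (nn rT0) f1 f2 s1 s2 t1 t2.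
move: (boundary_degree A (chart r rS0))%:~R (boundary_degree A (chart r rE1))%:~R
  (boundary_degree A (chart r rT1))%:~R (boundary_degree A (chart r rS1))%:~R
  (boundary_degree A (chart r rE2))%:~R (boundary_degree A (chart r rT0))%:~R.
move=> n0 n1 n2 n3 n4 n5 p0 p1 p2 p3 p4 p5 f1 f2 s1 s2 t1 t2.
have [le41|lt14] := lerP n4 n1; split.
- move=> _; rewrite f1.
  have := mulr_ge0 p2 S0; have := mulr_ge0 p0 T0.
  have := ler_wpM2l p1 Um; have : 0 <= (n1 - n4) * u rE2 by rewrite mulr_ge0 // subr_ge0.
  by lra.
- move=> _ Sm; rewrite f1 s1 mulrDl.
  have := ler_wpM2l p2 Sm; have := mulr_ge0 p0 T0; have := mulr_ge0 p4 b0.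
  have := ler_wpM2l p1 Um; have : 0 <= (n1 - n4) * u rE2 by rewrite mulr_ge0 // subr_ge0.
  by lra.
- move=> _ Tm; rewrite f1 t1 mulrDl.
  have := ler_wpM2l p0 Tm; have := mulr_ge0 p2 S0; have := mulr_ge0 p4 b0.
  have := ler_wpM2l p1 Um; have : 0 <= (n1 - n4) * u rE2 by rewrite mulr_ge0 // subr_ge0.
  by lra.
- move=> V0.
  have -> : log_weight A w = n5 * (u rS1 + u rE2) + n3 * (u rE2 + u rT0)
      + n1 * (u rS0 + u rT0) + (n4 - n1) * (u rS1 + u rE2 + u rT0).
    by rewrite f2 -tu; ring.
  have := mulr_ge0 p5 S0; have := mulr_ge0 p3 T0.
  have := ler_wpM2l p1 Um; have : 0 <= (n4 - n1) * (u rS1 + u rE2 + u rT0).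
    by rewrite mulr_ge0 // subr_ge0 ltW.
  by lra.
- move=> bu Sm; rewrite f2 s2 mulrDl.
  have := ler_wpM2l p5 Sm; have := mulr_ge0 p3 T0; have := mulr_ge0 p1 b0.
  have := ler_wpM2l p4 Um; have : 0 <= (n4 - n1) * (u rE1 + b).
    by rewrite mulr_ge0 //; lra.
  rewrite [X in 0 <= X -> _](_ : _ = (n4 - n1) * u rE1 + n4 * b - n1 * b); last by ring.
  by lra.
- move=> bu Tm; rewrite f2 t2 mulrDl.
  have := ler_wpM2l p3 Tm; have := mulr_ge0 p5 S0; have := mulr_ge0 p1 b0.
  have := ler_wpM2l p4 Um; have : 0 <= (n4 - n1) * (u rE1 + b).
    by rewrite mulr_ge0 //; lra.
  rewrite [X in 0 <= X -> _](_ : _ = (n4 - n1) * u rE1 + n4 * b - n1 * b); last by ring.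
  by lra.
Qed.

Lemma nonzero_int_norm_ge1 (n : int) : n != 0 -> 1 <= `|n%:~R| :> R.
Proof. by move=> n0; rewrite -intr_norm ler1z; lia. Qed.

(** The torus element which agrees with z in absolute value in the coordinates S0,
   S1, E2 and T0 of the chart; the two others follow from [torus_log]. *)
Definition chart_log (r : bool) (z : 'I_6 -> R) (k : 'I_6) : R :=
  let L j := ln `|z (chart r j)| in
  let j := chart r k in
  if j == rE1 then L rS1 + L rE2 - L rS0
  else if j == rT1 then L rS0 + L rT0 - L rS1 else L j.

(** The quotient of z by this torus element: the point of the chart with affine
   coordinates |s0/s1| and |u1/u0|. *)
Definition chart_bounded (r : bool) (z : 'I_6 -> R) (k : 'I_6) : R :=
  let j := chart r k in
  if j == rE1 then `|ratioS r z| else if j == rT1 then `|ratioU r z| else 1.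

Lemma chart_log_torus r z : torus_log (chart_log r z).
Proof.
rewrite /chart_log /chart; case: r; split; rewrite /opposite /=; ring.
Qed.

Lemma chart_logE r z j : j != rE1 -> j != rT1 ->
  chart_log r z (chart r j) = ln `|z (chart r j)|.
Proof. by move=> j1 j2; rewrite /chart_log chartK (negbTE j1) (negbTE j2). Qed.

Lemma norm_chart_log r (z : 'I_6 -> R) k :
  z (chart r rS0) != 0 -> z (chart r rS1) != 0 -> z (chart r rE2) != 0 ->
  z (chart r rT0) != 0 -> `|z k| = expR (chart_log r z k) * chart_bounded r z k.
Proof.
move=> z0 z3 z4 z5; rewrite -[k in LHS](chartK r) /chart_log /chart_bounded.
have LE j : z (chart r j) != 0 -> expR (ln `|z (chart r j)|) = `|z (chart r j)|.
  by move=> zj; rewrite lnK // posrE normr_gt0.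
case: (ord6E (chart r k)) => [] [] -> /=; rewrite ?mulr1 ?LE //.
- rewrite expRD expRN expRD !LE // /ratioS normf_div !normrM; field.
  by rewrite !normr_eq0 z0 z3 z4.
- rewrite expRD expRN expRD !LE // /ratioU normf_div !normrM; field.
  by rewrite !normr_eq0 z0 z3 z5.
Qed.

Lemma chart_log_E1 r (z : 'I_6 -> R) (b : R) :
  z (chart r rS0) != 0 -> z (chart r rS1) != 0 -> z (chart r rE2) != 0 ->
  1 <= `|z (chart r rE1)| -> `|ratioS r z| <= b -> - ln b <= chart_log r z (chart r rE1).
Proof.
move=> z0 z3 z4 z1 Sb; have z1p : z (chart r rE1) != 0.
  by rewrite -normr_gt0 (lt_le_trans ltr01).
have Sp : 0 < `|ratioS r z|.
  by rewrite /ratioS normr_gt0 mulf_neq0 ?invr_neq0 ?mulf_neq0.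
have : ln `|ratioS r z| <= ln b by rewrite ler_ln ?posrE // (lt_le_trans Sp).
rewrite /chart_log chartK /= /ratioS normf_div !normrM.
rewrite ln_div ?posrE ?mulr_gt0 ?normr_gt0 //.
rewrite !lnM ?posrE ?normr_gt0 //.
by have := ln_ge0 z1; lra.
Qed.

End Charts.

(** * Lower bound for the heights of integral points *)

Section HeightLowerBound.
Variables (R : realType) (p : 'I_6 -> int).
Local Notation C := R[i].
Hypotheses (zp : zpt p) (Dp : curveD R (ofZ C p)).

Lemma chart_moving r k : k \in [:: rS0; rT0; rT1; rS1] -> `|p (chart r k)| = 1.
Proof.
move=> kk; apply: (moving_unit zp Dp); move: kk; rewrite !inE.
by move=> /or4P [] /eqP ->; rewrite /chart; case: r.
Qed.

Lemma chart_det r (T : comNzRingType) (y : 'I_6 -> T) :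
  y (chart r rS0) * y (chart r rT0) - y (chart r rT1) * y (chart r rS1)
  = (if r then -1 else 1) * (y rS0 * y rT0 - y rT1 * y rS1).
Proof. by rewrite /chart; case: r; rewrite /opposite /=; ring. Qed.

Lemma ratioU_det r (z : 'I_6 -> R) :
  z (chart r rS0) != 0 -> z (chart r rT0) != 0 ->
  `|ratioU r z - 1| = `|z rS0 * z rT0 - z rT1 * z rS1|
    / (`|z (chart r rS0)| * `|z (chart r rT0)|).
Proof.
move=> z0 z5; rewrite /ratioU -normrM -normf_div -[LHS]normrN.
have -> : - (z (chart r rT1) * z (chart r rS1) / (z (chart r rS0) * z (chart r rT0)) - 1)
  = (if r then -1 else 1) * ((z rS0 * z rT0 - z rT1 * z rS1)
      / (z (chart r rS0) * z (chart r rT0))).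
  by rewrite mulrA -chart_det; field; rewrite z0 z5.
by case: (r); rewrite ?mul1r ?mulN1r ?normrN.
Qed.

(** Liouville's inequality: two distinct fractions differ by at least the inverse
   of the product of their denominators. *)
Lemma ratio_gap (a b a' b' : int) (d : R) :
  b != 0 -> b' != 0 -> 0 < d ->
  a%:~R / b%:~R != a'%:~R / b'%:~R :> R ->
  `|a%:~R / b%:~R - a'%:~R / b'%:~R| <= 2 * d :> R ->
  (2 * `|b'%:~R| * d)^-1 <= `|b%:~R| :> R.
Proof.
move=> b0 b'0 d0 ne le.
have bR : b%:~R != 0 :> R by rewrite intr_eq0.
have b'R : b'%:~R != 0 :> R by rewrite intr_eq0.
have e : a%:~R / b%:~R - a'%:~R / b'%:~R
    = (a * b' - a' * b)%:~R / (b%:~R * b'%:~R) :> R.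
  by rewrite intrB !intrM; field; rewrite bR b'R.
have n0 : a * b' - a' * b != 0.
  apply: contraNneq ne => h; rewrite -subr_eq0 e h mul0r //.
have bp : 0 < `|b%:~R| :> R by rewrite normr_gt0.
have b'p : 0 < `|b'%:~R| :> R by rewrite normr_gt0.
move: le; rewrite e normrM normfV normrM ler_pdivrMr ?mulr_gt0 // => le.
have h := le_trans (nonzero_int_norm_ge1 R n0) le.
rewrite -[leLHS]mul1r ler_pdivrMr ?mulr_gt0 //.
by apply: le_trans h _; rewrite le_eqVlt; apply/orP; left; apply/eqP; ring.
Qed.

(** The bounds of [log_weight_lower] hold with m = log (1/d) up to a constant.  If p
   is on an exceptional curve, the bound on u suffices.  Otherwise the point
   differs from p in s or in t, for if it agreed in both it would agree in u and
   lie on D; each case excludes one of the two lines. *)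
Lemma height_lower (r : bool) (A : toric_div) (H : ('I_6 -> int) -> R) (E : int) :
  `|p (chart r rE1)| <= `|p (chart r rE2)| -> weil_height R A H ->
  (forall k, 0 <= boundary_degree A k) -> 0 <= E ->
  (p (chart r rE1) = 0 -> E <= boundary_degree A (chart r rE1)) ->
  (p (chart r rE1) != 0 -> E <= A rS0 + A rS1 /\ E <= A rT1 + A rT0) ->
  exists c d0 : R, [/\ 0 < c, 0 < d0 & forall y, integralU R y ->
    dist (ofZ R p) (ofZ R y) < d0 ->
    0 < dist (ofZ R p) (ofZ R y) /\
    c * expR (- (E%:~R * ln (dist (ofZ R p) (ofZ R y)))) <= H y].
Proof.
move=> p14 HA nef E0 Ez Enz.
pose q := ofZ R p.
have uq k : k \in [:: rS0; rT0; rT1; rS1] -> `|q k| = 1.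
  by move=> kk; rewrite /q /ofZ -intr_norm (moving_unit zp Dp kk).
have uc k : k \in [:: rS0; rT0; rT1; rS1] -> `|q (chart r k)| = 1.
  by move=> kk; rewrite /q /ofZ -intr_norm chart_moving.
have p4 : p (chart r rE2) != 0.
  apply/eqP => p40; have p10 : p (chart r rE1) = 0.
    by apply/eqP; rewrite -normr_le0 (le_trans p14) // p40 normr0.
  have := zp (i := chart r rE1) (j := chart r rE2); rewrite p10 p40.
  by rewrite /chart; case: (r) => /(_ isT isT).
pose Q : R := `|q (chart r rE2)|.
have Q1 : 1 <= Q by exact: nonzero_int_norm_ge1.
have Q0 : 0 < Q := lt_le_trans ltr01 Q1.
have q4 : q (chart r rE2) != 0 by rewrite -normr_gt0.
have q14 : `|q (chart r rE1)| <= Q by rewrite /Q /q /ofZ -!intr_norm ler_int.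
have S1 : `|ratioS r q| <= 1.
  rewrite /ratioS normf_div !normrM (uc rS0) // (uc rS1) // !mul1r ler_pdivrMr // mul1r //.
have Uq : ratioU r q = 1.
  apply/eqP; rewrite -subr_eq0 -normr_eq0 ratioU_det; last 2 first.
  - by rewrite -normr_eq0 uc ?oner_eq0.
  - by rewrite -normr_eq0 uc ?oner_eq0.
  by rewrite /q /ofZ -!intrM -intrB (det_of_curveD Dp) subrr normr0 mul0r.
pose t : R := if p (chart r rE1) == 0 then 1 else `|ratioS r q|.
have t0 : 0 < t.
  rewrite /t; case: eqP => // /eqP p1; rewrite normr_gt0 /ratioS mulf_neq0 //.
    by rewrite mulf_neq0 ?intr_eq0 // -(intr_eq0 R) -/(ofZ R p _) -normr_eq0 uc ?oner_eq0.
  by rewrite invr_neq0 // mulf_neq0 // -normr_eq0 uc ?oner_eq0.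
(* near p the bounded factors are at least k where p is nonzero *)
pose k : R := Num.min 2^-1 (t / 2).
have k0 : 0 < k by rewrite lt_min; apply/andP; split; lra.
have [c [c0 Hc]] := weil_height_compare 2 HA (zpt_coxpt C zp) k0.
pose n4 : R := (boundary_degree A (chart r rE2))%:~R.
(* near p the ratio s0/s1 is at most 2, so the logarithm of E1 is at least - b *)
pose b : R := ln 2.
have b0 : 0 <= b by rewrite ln_ge0 //; lra.
exists (c^-1 * expR (- (E%:~R * ln (2 * Q)) - n4 * b)).
exists (Num.min (Num.min 4^-1 (2 * Q)^-1) (t / 4)).
split; first by rewrite mulr_gt0 ?expR_gt0 // invr_gt0.
  by rewrite !lt_min; repeat (apply/andP; split); rewrite ?invr_gt0 ?mulr_gt0.
move=> y Uy; set z := ofZ R y; set d := dist _ _.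
rewrite !lt_min => /andP [/andP [d4 dQ] dt].
have zy : zpt y by case: Uy.
have det := integralU_det Uy.
have d2 : dist q z <= 2^-1 by rewrite -/d; lra.
have [[z0 z3 z4 z5] [eS eT eU]] := chart_estimates uq q14 q4 (zpt_coxpt R zy) d2.
rewrite -/z -/d in z0 z3 z4 z5 eS eT eU.
have zdet : `|z rS0 * z rT0 - z rT1 * z rS1| = 1.
  by rewrite /z /ofZ -!intrM -intrB -intr_norm det.
have eU1 : (`|z (chart r rS0)| * `|z (chart r rT0)|)^-1 <= 2 * d.
  by move: eU; rewrite Uq ratioU_det // zdet mul1r.
have zz : 0 < `|z (chart r rS0)| * `|z (chart r rT0)| by rewrite mulr_gt0 ?normr_gt0.
have dp : 0 < d.
  have : 0 < 2 * d by apply: lt_le_trans eU1; rewrite invr_gt0.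
  by rewrite pmulr_rgt0.
split=> //.
have v1 : `|ratioS r z| <= 2.
  have := ler_distD (ratioS r q) (ratioS r z) 0; rewrite !subr0; lra.
have v1k : p (chart r rE1) != 0 -> k <= `|ratioS r z|.
  move=> p1; rewrite /k ge_min; apply/orP; right.
  have := ler_distD (ratioS r z) (ratioS r q) 0; rewrite !subr0 distrC.
  by move: dt; rewrite /t (negbTE p1); lra.
have v2 : `|ratioU r z| <= 2.
  by have := ler_distD 1 (ratioU r z) 0; move: eU; rewrite Uq !subr0 normr1; lra.
have v2k : k <= `|ratioU r z|.
  rewrite /k ge_min; apply/orP; left.
  by have := ler_distD (ratioU r z) 1 0; move: eU; rewrite Uq !subr0 normr1 distrC; lra.
have yE j : `|(y j)%:~R| = expR (chart_log r z j) * chart_bounded r z j.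
  exact: norm_chart_log.
have k1 : k <= 1 by rewrite /k ge_min; apply/orP; left; lra.
set w := chart_log r z in yE.
have tw : torus_log w by exact: chart_log_torus.
have := Hc y w (chart_bounded r z) zy tw yE; case/(_ _ _)/andP => [j|j pj|Hy _].
- rewrite /chart_bounded; case: ifP => _; first by rewrite normr_ge0.
  by case: ifP => _; [rewrite normr_ge0|lra].
- rewrite /chart_bounded; case: eqP => [e|_]; last by case: ifP.
  by apply: v1k; rewrite -e chartK; move: pj; rewrite /ofZ intr_eq0.
apply: le_trans Hy; rewrite -mulrA ler_pM2l ?invr_gt0 // -expRD ler_expR.
pose m := - ln (2 * Q * d).
have Q2 : 0 < 2 * Q by apply: mulr_gt0.
have Qd : 0 < 2 * Q * d by apply: mulr_gt0.
pose L j : R := ln `|z (chart r j)|.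
have wE j : j != rE1 -> j != rT1 -> w (chart r j) = L j by exact: chart_logE.
have zge1 j : z (chart r j) != 0 -> 1 <= `|z (chart r j)|.
  by move=> zj; rewrite nonzero_int_norm_ge1 // -(intr_eq0 R).
have Lge0 j : z (chart r j) != 0 -> 0 <= L j by move=> /zge1 /ln_ge0.
have m0 : 0 <= m.
  rewrite oppr_ge0 ln_le0 //; move: dQ; rewrite -[(2 * Q)^-1]mul1r ltr_pdivlMr ?mulr_gt0 //.
  by move=> h; rewrite mulrC ltW.
have lnM2 i j : z (chart r i) != 0 -> z (chart r j) != 0 ->
    L i + L j = ln (`|z (chart r i)| * `|z (chart r j)|).
  by move=> zi zj; rewrite lnM ?posrE ?normr_gt0.
have Um : m <= w (chart r rS0) + w (chart r rT0).
  rewrite !wE // lnM2 //; apply: ln_lower => //.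
  rewrite -[leRHS]invrK lef_pV2 ?posrE ?invr_gt0 //; apply: le_trans eU1 _.
  by rewrite mulrAC ler_peMr // mulr_ge0 // ltW.
have [] := @log_weight_lower R r A w m b tw nef b0 _ _ _ Um;
  rewrite ?(wE rS0) ?(wE rS1) ?(wE rE2) ?(wE rT0) ?addr_ge0 ?Lge0 //.
move=> D1 D2 D3.
have goalE : E%:~R * m - n4 * b <= log_weight A w ->
    - (E%:~R * ln (2 * Q)) - n4 * b + - (E%:~R * ln d) <= log_weight A w.
  by apply: le_trans; rewrite /m [ln (2 * Q * d)]lnM ?posrE // mulrN mulrDr; lra.
apply: goalE.
have n40 : 0 <= n4 by rewrite ler0z.
have nb : 0 <= n4 * b by rewrite mulr_ge0.
case: (eqVneq (p (chart r rE1)) 0) => [p1|p1].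
  have := D1 isT.
  have := ler_wpM2r m0 (_ : E%:~R <= (boundary_degree A (chart r rE1))%:~R :> R).
  by rewrite ler_int => /(_ (Ez p1)); lra.
have [E1 E2] := Enz p1.
have bu : - b <= w (chart r rE1).
  apply: chart_log_E1 => //; apply: zge1.
  have := lt_le_trans k0 (v1k p1); rewrite normr_gt0 /ratioS mulf_eq0 negb_or.
  by rewrite mulf_eq0 negb_or => /andP [/andP [_ ->]].
have intz j : z (chart r j) = (y (chart r j))%:~R by [].
have intq j : q (chart r j) = (p (chart r j))%:~R by [].
have p0n j : j \in [:: rS0; rT0; rT1; rS1] -> p (chart r j) != 0.
  by move=> jj; rewrite -(intr_eq0 R) -intq -normr_eq0 uc ?oner_eq0.
have y0n j : z (chart r j) != 0 -> y (chart r j) != 0 by rewrite intz intr_eq0.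
case: (eqVneq (ratioS r z) (ratioS r q)) => [Seq|Sne].
  have Tne : ratioT r z != ratioT r q.
    have rel (x : 'I_6 -> R) : x (chart r rS0) != 0 -> x (chart r rS1) != 0 ->
        x (chart r rT0) != 0 -> x (chart r rE2) != 0 ->
        ratioT r x = ratioS r x * ratioU r x.
      by move=> x0 x3 x5 x4; rewrite /ratioS /ratioT /ratioU; field; rewrite x0 x3 x4 x5.
    have qn j : j \in [:: rS0; rT0; rT1; rS1] -> q (chart r j) != 0.
      by move=> jj; rewrite -normr_eq0 uc ?oner_eq0.
    rewrite (rel z) // (rel q) ?q4 ?qn // Uq mulr1 Seq.
    have Sn : ratioS r q != 0 by move: t0; rewrite /t (negbTE p1) normr_gt0.
    apply/eqP => h.
    have U1 : ratioU r z = 1 by apply: (mulfI Sn); rewrite h mulr1.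
    have := ratioU_det z0 z5; rewrite U1 subrr normr0 zdet mul1r => /esym /eqP.
    by rewrite invr_eq0 gt_eqF.
  have Tm : m <= L rE2 + L rT0.
    rewrite addrC lnM2 //; apply: (ln_lower _ Qd); first by rewrite mulr_gt0 ?normr_gt0.
    have := @ratio_gap (y (chart r rT1) * y (chart r rE1)) (y (chart r rT0) * y (chart r rE2))
      (p (chart r rT1) * p (chart r rE1)) (p (chart r rT0) * p (chart r rE2)) d.
    rewrite !intrM -!intz -!intq !normrM (uc rT0) // mul1r -/Q; apply => //.
    - by rewrite mulf_neq0 ?y0n.
    - by rewrite mulf_neq0 ?p4 ?p0n.
  have := D3 bu Tm; have := ler_wpM2r m0 (_ : E%:~R <= (A rT1 + A rT0)%:~R :> R).
  by rewrite ler_int => /(_ E2); lra.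
have Sm : m <= L rS1 + L rE2.
  rewrite lnM2 //; apply: (ln_lower _ Qd); first by rewrite mulr_gt0 ?normr_gt0.
  have := @ratio_gap (y (chart r rS0) * y (chart r rE1)) (y (chart r rS1) * y (chart r rE2))
    (p (chart r rS0) * p (chart r rE1)) (p (chart r rS1) * p (chart r rE2)) d.
  rewrite !intrM -!intz -!intq !normrM (uc rS1) // mul1r -/Q; apply => //.
  - by rewrite mulf_neq0 ?y0n.
  - by rewrite mulf_neq0 ?p4 ?p0n.
have := D2 bu Sm; have := ler_wpM2r m0 (_ : E%:~R <= (A rS0 + A rS1)%:~R :> R).
by rewrite ler_int => /(_ E1); lra.
Qed.

End HeightLowerBound.

(** * Approximation constants *)

(** Some monomial section of a multiple of A is nonzero at the general point of
   the boundary curve k, so its divisor meets this curve properly. *)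
Lemma nef_of_globally_generated (R : realType) (A : toric_div) (n : nat) k :
  (0 < n)%N -> globally_generated R (A *+ n) -> 0 <= boundary_degree A k.
Proof.
move=> n0 ggA; pose y (j : 'I_6) : R[i] := (j != k)%:R.
have cy : coxpt y.
  move=> a b ab _; rewrite /y; case: (eqVneq a k) ab => [->|_ _]; last first.
    by rewrite oner_neq0.
  by rewrite eq_sym => ->; rewrite oner_neq0 orbT.
have [m [[u Hu] mk]] := globally_generated_monomial ggA cy.
have {}mk : m k = 0%N by apply: mk; rewrite /y eqxx.
have E j : (m j)%:Z = n%:Z * A j + u.1 * (ray j).1 + u.2 * (ray j).2.
  by rewrite -addrA -Hu /monomial_div !ffunE ffunMnE -mulr_natl natz addrC subrK.
have rayE : (ray (ordS k)).1 + (ray (ord_pred k)).1 = (ray k).1 /\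
    (ray (ordS k)).2 + (ray (ord_pred k)).2 = (ray k).2.
  by case: (ord6E k) => [] [] ->.
have : n%:Z * boundary_degree A k = (m (ordS k) + m (ord_pred k))%N%:Z.
  have := E k; rewrite mk PoszD !E /boundary_degree -rayE.1 -rayE.2.
  set g := (X in 0%N%:Z = X -> _) => h; apply/eqP; rewrite -subr_eq0.
  rewrite [X in X == 0](_ : _ = - g); first by rewrite -h.
  by rewrite /g; ring.
have : 0 <= (m (ordS k) + m (ord_pred k))%N%:Z by [].
by move=> + e; rewrite -e pmulr_rge0 // ltz_nat.
Qed.

Section Alpha.
Variables (R : realType) (p : 'I_6 -> int).
Local Notation C := R[i].

(** If d^a H is bounded by M for a smaller exponent a, then log (1/d) is bounded,
   so d does not tend to zero. *)
Lemma alpha_ge (W : set ('I_6 -> int)) (H : ('I_6 -> int) -> R) (E c d0 : R) :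
  0 < c -> 0 < d0 ->
  (forall y, W y -> dist (ofZ R p) (ofZ R y) < d0 ->
    0 < dist (ofZ R p) (ofZ R y) /\
    c * expR (- (E * ln (dist (ofZ R p) (ofZ R y)))) <= H y) ->
  (E%:E <= alpha (ofZ R p) W H)%E.
Proof.
move=> c0 d00 low; rewrite /alpha; case: asboolP => _; last by rewrite leey.
apply: le_ereal_inf_tmp => _ [a [a0 [y [Wy dy [M HM]]]] <-].
rewrite lee_fin leNgt; apply/negP => aE.
pose B := M / c / (E - a).
have Ea : 0 < E - a by rewrite subr_gt0.
have r0 : 0 < Num.min d0 (expR (- B)) by rewrite lt_min d00 expR_gt0.
have /cvgrPdist_lt /(_ _ r0) [n _ /(_ n (leqnn n))] := dy.
rewrite sub0r normrN => dn; have {dn} := le_lt_trans (ler_norm _) dn.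
rewrite lt_min => /andP [d1 d2].
have [dp h] := low _ (Wy n).1 d1; have := HM n; move: d1 d2 dp h.
set d := dist _ _ => d1 d2 dp h hM.
have : c * expR ((E - a) * - ln d) <= M.
  apply: le_trans hM; rewrite /powR gt_eqF //.
  have -> : expR ((E - a) * - ln d) = expR (a * ln d) * expR (- (E * ln d)).
    by rewrite -expRD; congr expR; ring.
  by rewrite mulrCA ler_wpM2l ?expR_ge0.
have lnd : B < - ln d.
  by rewrite ltrNr -[ltRHS]expRK ltr_ln ?posrE ?expR_gt0.
have := expR_ge1Dx ((E - a) * - ln d).
have : M / c < (E - a) * - ln d by rewrite [ltRHS]mulrC -ltr_pdivrMr.
move=> h1 h2 h3; have : M < M; last by rewrite ltxx.
apply: lt_le_trans h3; rewrite [ltRHS]mulrC -ltr_pdivrMr //; lra.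
Qed.

Hypotheses (zp : zpt p) (Dp : curveD R (ofZ C p)).

(** Only the sequence of [alpha_line_le] is needed for the upper bound, and the
   lower bound passes to subsets; so every set of integral points between the
   sequence and all of U has the same constant. *)
Lemma alpha_line (r : bool) (A : toric_div) (l : contact_line p) (N : nat -> int)
    (H : ('I_6 -> int) -> R) (W : set ('I_6 -> int)) :
  `|p (chart r rE1)| <= `|p (chart r rE2)| ->
  (forall k, 0 <= boundary_degree A k) -> 0 <= line_degree l A ->
  (p (chart r rE1) = 0 -> line_degree l A <= boundary_degree A (chart r rE1)) ->
  (p (chart r rE1) != 0 ->
     line_degree l A <= A rS0 + A rS1 /\ line_degree l A <= A rT1 + A rT0) ->
  (forall n, n%:Z < N n) -> (forall n, zpt (line_pt l (N n + 1) (N n))) ->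
  W `<=` integralU R -> (forall n, W (line_pt l (N n + 1) (N n))) ->
  weil_height R A H -> alpha (ofZ R p) W H = ((line_degree l A)%:~R)%:E.
Proof.
move=> p14 nef E0 Ez Enz Nn zN WU WN HA.
apply/le_anti/andP; split; first exact: (alpha_line_le zp Dp HA E0 Nn zN WN).
have [c [d0 [c0 d00 low]]] := height_lower zp Dp p14 HA nef E0 Ez Enz.
by apply: (alpha_ge c0 d00) => y /WU; exact: low.
Qed.

Lemma line_pt_integral (l : contact_line p) (N : int) :
  zpt (line_pt l (N + 1) N) -> integralU R (line_pt l (N + 1) N).
Proof.
move=> zN; apply: det_integralU => //; rewrite (line_pt_det Dp) addrAC subrr add0r mulr1.
by rewrite normrM !(moving_unit zp Dp) ?inE ?eqxx ?orbT ?mulr1.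
Qed.

(** If p is on no exceptional curve, the line is the one of smaller degree among
   the two on which s or t is constant. *)
Lemma minimal_line (A : toric_div) : (forall k, 0 <= boundary_degree A k) ->
  exists r (l : contact_line p),
    [/\ `|p (chart r rE1)| <= `|p (chart r rE2)|, approximable l, 0 <= line_degree l A,
        p (chart r rE1) = 0 -> line_degree l A <= boundary_degree A (chart r rE1)
      & p (chart r rE1) != 0 ->
        line_degree l A <= A rS0 + A rS1 /\ line_degree l A <= A rT1 + A rT0].
Proof.
move=> nef; have [[h0 h1 h2] [h3 h4 h5]] := boundary_degreeE A.
have n0 := nef rS0; have n1 := nef rE1; have n2 := nef rT1; have n4 := nef rE2.
case: (eqVneq (p rE1) 0) => [p1|p1].
  have [l [al dl]] := line_E1 zp Dp p1.
  exists false, l; rewrite dl /chart p1 eqxx; split=> //; lia.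
case: (eqVneq (p rE2) 0) => [p4|p4].
  have [l [al dl]] := line_E2 zp Dp p4.
  exists true, l; rewrite dl /chart /opposite /= p4 eqxx; split=> //; lia.
have [r [rp rn]] : exists r, `|p (chart r rE1)| <= `|p (chart r rE2)| /\ p (chart r rE1) != 0.
  by case: (lerP `|p rE1| `|p rE2|) => h; [exists false|exists true; split=> //; exact: ltW].
case: (lerP (A rT0 + A rT1) (A rS0 + A rS1)) => le.
  have [l [_ _ al dl]] := line_constant_s zp Dp p1 p4.
  by exists r, l; rewrite dl; split=> // [|/eqP|_]; [lia|rewrite (negbTE rn)|lia].
have [l [_ _ al dl]] := line_constant_t zp Dp p1 p4.
by exists r, l; rewrite dl; split=> // [|/eqP|_]; [lia|rewrite (negbTE rn)|lia].
Qed.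

End Alpha.

Lemma zpt_x : zpt pt_x.
Proof. by []. Qed.

Lemma curveD_x (R : realType) : curveD R (ofZ R[i] pt_x).
Proof. by apply: curveD_torus => [i|]; rewrite /ofZ ?oner_neq0. Qed.

Lemma lineL_sub (R : realType) (k : 'I_2) (y : 'I_6 -> int) :
  zpt y -> y rE1 = 1 -> y rE2 = 1 ->
  (if k == 0 then y rS0 = 1 /\ y rS1 = 1 else y rT0 = 1 /\ y rT1 = 1) ->
  on_curve (lineL R k) y.
Proof.
move=> zy y1 y4 yk; split=> //; have cy := zpt_coxpt R[i] zy.
apply: zclosure_sub => //; move: yk; have n1 := oner_neq0 R[i].
case: ifP => k0 [h h'].
  have [S0 S1] : coordS (ofZ R[i] y) 0 = 1 /\ coordS (ofZ R[i] y) 1 = 1.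
    by rewrite /coordS /ofZ /= h h' y1 y4 mulr1.
  by split=> //=; rewrite ?k0 ?S0 ?S1 //; case=> /eqP; rewrite (negbTE n1).
have [T0 T1] : coordT (ofZ R[i] y) 0 = 1 /\ coordT (ofZ R[i] y) 1 = 1.
  by rewrite /coordT /ofZ /= h h' y1 y4 mulr1.
by split=> //=; rewrite ?k0 ?T0 ?T1 //; case=> _ /eqP; rewrite (negbTE n1).
Qed.

Theorem theorem5p3 (R : realType) :
  (forall H : ('I_6 -> int) -> R, weil_height R log_anticanonical H ->
     alpha (ofZ R pt_x) (integralU R) H = 1%:E /\
     forall k : 'I_2,
       alpha (ofZ R pt_x) (on_curve (lineL R k) `&` integralU R) H = 1%:E)
  /\
  (forall p : 'I_6 -> int, zpt p -> curveD R (ofZ R[i] p) ->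
     (exists Z, minimal_stratum R Z /\ Z (ofZ R[i] p)) ->
     forall A : toric_div, ample R A ->
     exists Y : set ('I_6 -> R[i]),
       [/\ rational_curve R Y,
           log_rational R Y \/ toroidal R Y
         & forall H : ('I_6 -> int) -> R, weil_height R A H ->
             alpha (ofZ R p) (integralU R) H
             = alpha (ofZ R p) (on_curve Y `&` integralU R) H]).
Proof.
split=> [H HA|p zp Dp _ A [n [n0 [ggA _ _]]]].
  have nef k : 0 <= boundary_degree log_anticanonical k.
    exact: (@nef_of_globally_generated R _ 1 k isT (@globally_generated_log R)).
  have Dx := curveD_x R.
  have [l1 [i1 j1 [N1 [Nn1 zN1]] d1]] := line_constant_s zpt_x Dx isT isT.
  have [l2 [i2 j2 [N2 [Nn2 zN2]] d2]] := line_constant_t zpt_x Dx isT isT.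
  have {}d1 : line_degree l1 log_anticanonical = 1 by rewrite d1 !log_anticanonicalE.
  have {}d2 : line_degree l2 log_anticanonical = 1 by rewrite d2 !log_anticanonicalE.
  have U1 n : integralU R (line_pt l1 (N1 n + 1) (N1 n)) by apply: line_pt_integral zpt_x Dx _ _ _.
  have U2 n : integralU R (line_pt l2 (N2 n + 1) (N2 n)) by apply: line_pt_integral zpt_x Dx _ _ _.
  have a1 W : W `<=` integralU R -> (forall n, W (line_pt l1 (N1 n + 1) (N1 n))) ->
      alpha (ofZ R pt_x) W H = 1%:E.
    move=> WU WN; rewrite (alpha_line (r := false) zpt_x Dx _ nef _ _ _ Nn1 zN1 WU WN HA) ?d1 //.
    by rewrite !log_anticanonicalE.
  have a2 W : W `<=` integralU R -> (forall n, W (line_pt l2 (N2 n + 1) (N2 n))) ->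
      alpha (ofZ R pt_x) W H = 1%:E.
    move=> WU WN; rewrite (alpha_line (r := false) zpt_x Dx _ nef _ _ _ Nn2 zN2 WU WN HA) ?d2 //.
    by rewrite !log_anticanonicalE.
  split; first exact: a1.
  move=> k; case: (ord2E k) => ->.
    apply: a1 => [y []//|n]; split=> //; apply: lineL_sub => //;
      by rewrite /line_pt /line_factor i1 j1.
  apply: a2 => [y []//|n]; split=> //; apply: lineL_sub => //;
    by rewrite /line_pt /line_factor i2 j2.
have nef k : 0 <= boundary_degree A k by exact: nef_of_globally_generated n0 ggA.
have [r [l [pr [N [Nn zN]] E0 Ez Enz]]] := minimal_line zp Dp nef.
exists (line_curve zp Dp l); split; first exact: line_rational.
  by left; exact: line_log_rational.
move=> H HA.
have NU m : integralU R (line_pt l (N m + 1) (N m)) by apply: line_pt_integral zp Dp _ _ _.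
have aE W WU WN := @alpha_line R p zp Dp r A l N H W pr nef E0 Ez Enz Nn zN WU WN HA.
rewrite [LHS]aE // [RHS]aE // => m.
split=> //; apply: line_pt_on_curve => //.
by have := Nn m; lia.
Qed.
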